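(* Let $k$ be a field and $\Delta$ a simplicial complex on $n$ vertices. The following are equivalent: (1) There is a graded isomorphism of $k[\Delta]$-modules $\omega_{k[\Delta]}\cong k[\Delta]$. (2) $\Delta$ is a normal pseudomanifold and $H_{\dim\Delta}(\Delta;k)\neq 0$.
   Context: Let $R=k[X_1,\dots,X_n]$ with the standard grading. The Stanley-Reisner ideal $I_\Delta\subseteq R$ is generated by the monomials $X_{i_1}\cdots X_{i_s}$ such that $\{i_1,\dots,i_s\}$ is not a face of $\Delta$; $k[\Delta]=R/I_\Delta$; and $\omega_{k[\Delta]}=\mathrm{Ext}_R^{n-\dim k[\Delta]}(k[\Delta],R(-n))$ with its natural grading (also when $k[\Delta]$ is not Cohen-Macaulay). For a face $\sigma$, $\dim\sigma=|\sigma|-1$ (an $i$-face is a face of dimension $i$; the empty face has dimension $-1$), $\dim\Delta=\max_{\sigma\in\Delta}\dim\sigma$, and $\mathrm{lk}_\Delta\sigma=\{\tau\in\Delta:\tau\cup\sigma\in\Delta,\ \tau\cap\sigma=\emptyset\}$. Facets are the inclusion-maximal faces; $\Delta$ is pure $d$-dimensional if all facets have dimension $d$. A pure $d$-dimensional simplicial complex $\Delta$ is a normal pseudomanifold if (i) $\mathrm{lk}_\Delta(\sigma)$ is connected for every $i$-face $\sigma$ with $i\le d-2$ (including the empty face when $-1\le d-2$), and (ii) every $(d-1)$-face is contained in exactly two $d$-faces. *)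

(* Defs.v *)
From HB Require Import structures.
From mathcomp Require Import all_boot all_order all_algebra.
From mathcomp Require Import boolp.
From mathcomp Require Import mpoly.

Set Implicit Arguments.
Unset Strict Implicit.
Unset Printing Implicit Defensive.

Import Order.TTheory GRing.Theory Num.Theory.
Local Open Scope ring_scope.
Local Open Scope quotient_scope.

Section ModuleQuotient.
Variables (R : nzRingType) (V : lmodType R) (B : submodClosed V).

(* [submodClosed] is stated for semimodules, and does not provide closure
   under opposite. *)
Definition submod_pred : pred V := fun x => x \in B.

Lemma submod_pred_zmod : zmod_closed submod_pred.
Proof.
split=> [|x y Bx By]; rewrite unfold_in /submod_pred; first exact: rpred0.
by rewrite -scaleN1r; apply: rpredD => //; apply: rpredZ.
Qed.

HB.instance Definition _ := GRing.isZmodClosed.Build V submod_pred submod_pred_zmod.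

Definition submod_zmod : zmodClosed V :=
  GRing.ZmodClosed.clone V submod_pred _.

Definition mquot : Type := Quotient.quot submod_zmod.
HB.instance Definition _ := GRing.Zmodule.on mquot.

Definition mquot_pi (x : V) : mquot := \pi_(Quotient.quot submod_zmod) x.

Lemma mquot_piE x y : (mquot_pi x = mquot_pi y) <-> (x - y \in B).
Proof.
have -> : (x - y \in B) = (x - y \in submod_zmod) by [].
by rewrite Quotient.idealrBE; split=> /eqP.
Qed.

Lemma mquot_piK (x : mquot) : mquot_pi (repr x) = x.
Proof. exact: reprK. Qed.

Lemma mquot_pi_zmod : zmod_morphism mquot_pi.
Proof. by move=> x y; rewrite /mquot_pi; apply: raddfB. Qed.

HB.instance Definition _ :=
  GRing.isZmodMorphism.Build V mquot mquot_pi mquot_pi_zmod.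

Definition mquot_scale (a : R) (x : mquot) : mquot := mquot_pi (a *: repr x).

Lemma mquot_pi_scale a x : mquot_scale a (mquot_pi x) = mquot_pi (a *: x).
Proof.
by apply/mquot_piE; rewrite -scalerBr; apply/rpredZ/mquot_piE/mquot_piK.
Qed.

Lemma mquot_scaleA a b x :
  mquot_scale a (mquot_scale b x) = mquot_scale (a * b) x.
Proof. by rewrite -[x]mquot_piK !mquot_pi_scale scalerA. Qed.

Lemma mquot_scale1 : left_id 1 mquot_scale.
Proof. by move=> x; rewrite -[x]mquot_piK mquot_pi_scale scale1r. Qed.

Lemma mquot_scaleDr : right_distributive mquot_scale +%R.
Proof.
move=> a x y; rewrite -[x]mquot_piK -[y]mquot_piK -raddfD !mquot_pi_scale.
by rewrite scalerDr raddfD.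
Qed.

Lemma mquot_scaleDl x : {morph mquot_scale^~ x : a b / a + b}.
Proof.
by move=> a b; rewrite -[x]mquot_piK !mquot_pi_scale scalerDl raddfD.
Qed.

HB.instance Definition _ := GRing.Zmodule_isLmodule.Build R mquot
  mquot_scaleA mquot_scale1 mquot_scaleDr mquot_scaleDl.

Lemma mquot_pi_scalable : scalable mquot_pi.
Proof. by move=> a x; rewrite -mquot_pi_scale. Qed.

HB.instance Definition _ :=
  GRing.isScalable.Build R V mquot *:%R mquot_pi mquot_pi_scalable.
End ModuleQuotient.

Section Homology.
Variables (R : nzRingType) (U V W : lmodType R).
Variables (f : {linear U -> V}) (g : {linear V -> W}).

Definition in_ker : pred V := fun x => g x == 0.

Lemma in_ker_submod : submod_closed in_ker.
Proof.
split=> [|a x y]; rewrite !unfold_in /in_ker ?linear0 //.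
by move=> /eqP gx /eqP gy; rewrite linearP gx gy scaler0 addr0.
Qed.

HB.instance Definition _ := GRing.isSubmodClosed.Build R V in_ker in_ker_submod.

Definition cycle : Type := {x : V | x \in in_ker}.
HB.instance Definition _ := SubChoice.on cycle.
HB.instance Definition _ := [SubChoice_isSubLmodule of cycle by <:].

Definition in_im : pred cycle := fun z => `[< exists u, f u = val z >].

Lemma in_im_submod : submod_closed in_im.
Proof.
split=> [|a x y]; rewrite !unfold_in /in_im.
  by apply/asboolP; exists 0; rewrite !linear0.
move=> /asboolP[u fu] /asboolP[v fv]; apply/asboolP.
by exists (a *: u + v); rewrite !linearP fu fv.
Qed.

HB.instance Definition _ := GRing.isSubmodClosed.Build R cycle in_im in_im_submod.

(* ker g / im f; this is meant for [g \o f = 0], otherwise it is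
   ker g / (im f :&: ker g). *)
Definition homology : lmodType R := mquot (GRing.SubmodClosed.clone R cycle in_im _).

Definition homology_class (z : cycle) : homology := mquot_pi _ z.
End Homology.

(* The linear map with matrix [a]: [e_i |-> \sum_j a i j *: e_j]. *)
Section MatrixAction.
Variables (R : comNzRingType) (N : lmodType R) (I J : finType).
Variable a : I -> J -> R.

Definition mxact (x : {ffun I -> N}) : {ffun J -> N} :=
  [ffun j => \sum_i a i j *: x i].

Lemma mxact_linear : linear mxact.
Proof.
move=> c x y; apply/ffunP=> j; rewrite !ffunE scaler_sumr -big_split /=.
apply: eq_bigr => i _.
by rewrite !ffunE scalerDr !scalerA mulrC.
Qed.

HB.instance Definition _ :=
  GRing.isLinear.Build R {ffun I -> N} {ffun J -> N} *:%R mxact mxact_linear.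
End MatrixAction.

(* A module with a family of homogeneous components. The axioms of a grading
   play no role in the definitions below. *)
Record gmod (R : nzRingType) := GMod {
  gmod_sort :> lmodType R;
  gpiece : int -> gmod_sort -> Prop
}.

Definition graded_iso (R : nzRingType) (M N : gmod R) : Prop :=
  exists2 f : {linear M -> N},
    bijective f & forall j x, gpiece j x <-> gpiece j (f x).

Section GradedExt.
Variables (k : fieldType) (n : nat).
Local Notation R := {mpoly k[n]}.

Definition mpoly_piece (j : int) (p : R) : Prop :=
  match j with
  | Posz d => p \is d.-homog
  | Negz _ => p = 0
  end.

(* R(c), where R(c)_j = R_(c + j) *)
Definition mpoly_shift (c : int) : gmod R :=
  @GMod R R^o (fun j => mpoly_piece (c + j)).

(* A resolution ... -> F_1 -> F_0 -> M -> 0 by graded free modules of finite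
   rank: F_i has basis e_l, l : 'I_(gres_rank i), with e_l of degree
   gres_deg i l, and maps e_j in F_(i.+1) to \sum_l gres_d i j l *: e_l. *)
Record gresolution (M : gmod R) := GResolution {
  gres_rank : nat -> nat;
  gres_deg : forall i, 'I_(gres_rank i) -> int;
  gres_aug : 'I_(gres_rank 0) -> M;
  gres_d : forall i, 'I_(gres_rank i.+1) -> 'I_(gres_rank i) -> R;
  gres_aug_homog : forall l, gpiece (gres_deg l) (gres_aug l);
  gres_d_homog : forall i (j : 'I_(gres_rank i.+1)) l,
    mpoly_piece (gres_deg j - gres_deg l) (gres_d j l);
  gres_surj : forall m : M,
    exists x : {ffun 'I_(gres_rank 0) -> R^o}, m = \sum_l x l *: gres_aug l;
  gres_exact0 : forall x : {ffun 'I_(gres_rank 0) -> R^o},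
    \sum_l x l *: gres_aug l = 0 <-> exists y, x = mxact (@gres_d 0) y;
  gres_exactS : forall i (x : {ffun 'I_(gres_rank i.+1) -> R^o}),
    mxact (@gres_d i) x = 0 <-> exists y, x = mxact (@gres_d i.+1) y
}.

Section Ext.
Variables (M : gmod R) (F : gresolution M) (N : gmod R).

(* Hom(F_i, N), a homomorphism being given by its values on the basis. *)
Definition cochain (i : nat) : lmodType R := {ffun 'I_(gres_rank F i) -> N}.

Definition codiff (i : nat) : {linear cochain i -> cochain i.+1} :=
  mxact (fun l j => gres_d j l).

Definition codiff_in (i : nat) : {linear cochain i.-1 -> cochain i} :=
  match i with
  | 0 => \0
  | i'.+1 => codiff i'
  end.

(* Ext^i(M, N) computed with F; a homomorphism F_i -> N is homogeneous of
   degree j if it maps the degree-d component of F_i to N_(d + j). *)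
Definition Ext (i : nat) : gmod R :=
  @GMod R (homology (codiff_in i) (codiff i)) (fun j h =>
    exists2 z : cycle (codiff i),
      forall l, gpiece (gres_deg l + j) ((val z : cochain i) l)
      & h = homology_class (codiff_in i) z).
End Ext.
End GradedExt.

Section KrullDimension.
Variable A : comNzRingType.

Definition prime_chain (d : nat) : Prop :=
  exists P : nat -> prime_idealr A, forall i, (i < d)%N ->
    {subset P i <= P i.+1} /\ ~ {subset P i.+1 <= P i}.

Definition is_krull_dim (d : nat) : Prop :=
  prime_chain d /\ forall e, prime_chain e -> (e <= d)%N.

(* 0 if A has infinite dimension *)
Definition krull_dim : nat :=
  if pselect (exists d, is_krull_dim d) is left ex then sval (cid ex) else 0%N.
End KrullDimension.

Record scomplex (n : nat) := SComplex {
  faces :> {set {set 'I_n}};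
  faces0 : set0 \in faces;
  faces_vertex : forall v, [set v] \in faces;
  faces_sub : forall s t : {set 'I_n}, s \subset t -> t \in faces -> s \in faces
}.

Section Simplicial.
Variables (n : nat) (D : scomplex n).
Implicit Types s t : {set 'I_n}.

Definition fdim s : int := #|s|%:Z - 1.

Definition cdim : int := (\max_(s in faces D) #|s|)%N%:Z - 1.

Definition link s : {set {set 'I_n}} :=
  [set t in faces D | (t :|: s \in faces D) && (t :&: s == set0)].

(* A complex is connected iff its 1-skeleton is. *)
Definition connected (K : {set {set 'I_n}}) : Prop :=
  forall u v, [set u] \in K -> [set v] \in K ->
    connect (fun x y => [set x; y] \in K) u v.

Definition facet s : Prop :=
  s \in faces D /\ forall t, t \in faces D -> s \subset t -> s = t.

Definition pure (d : int) : Prop := forall s, facet s -> fdim s = d.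

Definition normal_pseudomanifold : Prop :=
  [/\ pure cdim,
      forall s, s \in faces D -> fdim s <= cdim - 2 -> connected (link s)
    & forall s, s \in faces D -> fdim s = cdim - 1 ->
        #|[set t in faces D | (fdim t == cdim) && (s \subset t)]| = 2].

Section SimplicialHomology.
Variable k : fieldType.

Definition face_of_dim (i : int) : predArgType :=
  {s : {set 'I_n} | (s \in faces D) && (fdim s == i)}.

(* The coefficient of t in the boundary of s, for the order on 'I_n. *)
Definition incidence s t : k :=
  \sum_(v in s | t == s :\ v) (-1) ^+ #|[set u in s | (u < v)%N]|.

(* The empty face spans the chains of dimension -1, so that the homology
   below is the reduced one. *)
Definition chain (i : int) : lmodType k := {ffun face_of_dim i -> k^o}.

Definition boundary (i j : int) : {linear chain i -> chain j} :=
  mxact (fun (s : face_of_dim i) (t : face_of_dim j) =>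
    incidence (val s) (val t)).

Definition simplicial_homology (i : int) : lmodType k :=
  homology (boundary (i + 1) i) (boundary i (i - 1)).
End SimplicialHomology.
End Simplicial.

Section StanleyReisner.
Variables (k : fieldType) (n : nat) (D : scomplex n).
Local Notation R := {mpoly k[n]}.

Definition SR_ideal : pred R := fun p =>
  `[< exists c : {set 'I_n} -> R,
      p = \sum_(s : {set 'I_n} | s \notin faces D) c s * \prod_(i in s) 'X_i >].

Lemma SR_ideal_closed : idealr_closed SR_ideal.
Proof.
split; rewrite ?unfold_in /SR_ideal.
- apply/asboolP; exists (fun=> 0).
  by rewrite big1 // => s _; rewrite mul0r.
- apply/asboolP => -[c /(congr1 (meval (fun=> 0)))].
  rewrite rmorph1 raddf_sum big1 => [/eqP|s sD]; first by rewrite oner_eq0.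
  have [i si] : exists i, i \in s.
    by apply/set0Pn; apply: contraNneq sD => ->; apply: faces0.
  by rewrite (bigD1 i) //= mulrCA mevalM mevalXU mul0r.
- move=> a p q /asboolP[c ->] /asboolP[e ->]; apply/asboolP.
  exists (fun s => a * c s + e s).
  rewrite mulr_sumr -big_split /=.
  by apply: eq_bigr => s _; rewrite mulrDl mulrA.
Qed.

HB.instance Definition _ := isIdealr.Build R SR_ideal SR_ideal_closed.

Definition SR_ring : Type := {ideal_quot (Idealr.clone R SR_ideal _)}.
HB.instance Definition _ := GRing.ComNzRing.on SR_ring.

Definition SR_pi (p : R) : SR_ring := \pi_{ideal_quot _} p.

Lemma SR_pi_zmod : zmod_morphism SR_pi.
Proof. by move=> p q; rewrite /SR_pi; apply: raddfB. Qed.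

Lemma SR_pi_monoid : monoid_morphism SR_pi.
Proof.
by split=> [|p q]; rewrite /SR_pi; [apply: rmorph1 | apply: rmorphM].
Qed.

HB.instance Definition _ := GRing.isZmodMorphism.Build R SR_ring SR_pi SR_pi_zmod.
HB.instance Definition _ :=
  GRing.isMonoidMorphism.Build R SR_ring SR_pi SR_pi_monoid.

Definition SR_scale (p : R) (x : SR_ring) : SR_ring := SR_pi p * x.

Lemma SR_scaleA p q x : SR_scale p (SR_scale q x) = SR_scale (p * q) x.
Proof. by rewrite /SR_scale rmorphM mulrA. Qed.

Lemma SR_scale1 : left_id 1 SR_scale.
Proof. by move=> x; rewrite /SR_scale rmorph1 mul1r. Qed.

Lemma SR_scaleDr : right_distributive SR_scale +%R.
Proof. by move=> p x y; rewrite /SR_scale mulrDr. Qed.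

Lemma SR_scaleDl x : {morph SR_scale^~ x : p q / p + q}.
Proof. by move=> p q; rewrite /SR_scale rmorphD mulrDl. Qed.

HB.instance Definition _ := GRing.Zmodule_isLmodule.Build R SR_ring
  SR_scaleA SR_scale1 SR_scaleDr SR_scaleDl.

Definition SR_gmod : gmod R :=
  @GMod R SR_ring (fun j x => exists2 p, mpoly_piece j p & x = SR_pi p).

(* A k[D]-linear map is the same as an R-linear map between modules killed by
   SR_ideal, so the canonical module is kept as an R-module. *)
Definition omega (F : gresolution SR_gmod) : gmod R :=
  Ext F (mpoly_shift k n (- n%:Z)) (n - krull_dim SR_ring).
End StanleyReisner.

(* Main.v *)
(** The module omega is computed from the Cousin complex of R(-n), whose term in
degree i is the sum of the k[x_S^(+-1)] (x) k[x_v^-1 : v notin S] over the sets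
S of n - i vertices.  If S is not a face, then x_S kills k[D] and acts
bijectively on the summand of S, so that this summand contributes nothing to
Ext(k[D], -).  If d is the largest cardinality of a face, dimension shifting
therefore identifies omega = Ext^(n-d)(k[D], R(-n)) with the elements killed by
the Stanley-Reisner ideal in the kernel of the differential on the terms with
|S| = d.  In the multidegree a these are the relative cycles of dimension d - 1
supported on the facets containing supp a (and 0 unless a >= 0).

Hence omega and k[D] are isomorphic iff there is a top cycle w whose restrictions
span, and do not vanish on, the relative cycles around each face F.  For a normal
pseudomanifold, a relative cycle vanishing on one facet vanishes on all of them,
by walking through connected links; conversely, purity, the condition on ridges
and the connectedness of links are read off from the dimension 1 of the spaces
of relative cycles. *)
From HB Require Import structures.
From mathcomp Require Import all_boot all_order all_algebra.
From mathcomp Require Import boolp.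
From mathcomp Require Import mpoly ssrcomplements.
From mathcomp Require Import zify.
Require Import Defs.

Set Implicit Arguments.
Unset Strict Implicit.
Unset Printing Implicit Defensive.

Import Order.TTheory GRing.Theory Num.Theory.
Local Open Scope ring_scope.

(** * The Cousin complex of R(-n) *)

(** The difficulty is that [F] is an arbitrary graded free resolution, so nothing about Ext can be
    read off from its matrices. Two facts about [F] carry the argument: multiplication by an element
    that kills k[D] is null-homotopic on [F], and a cocycle in degree 0 is a homomorphism defined on
    k[D]. On the summand of a nonface S the inverse of x_S turns that null-homotopy into a
    contraction. Dimension shifting is a walk through the double complex Hom(F, Cousin) between the
    levels n and d: downwards it solves equations along [F], at levels above d; upwards it solves
    them along the Cousin differential, at levels below n. The walk involves choices, so it is kept
    as a relation, and the gradings are compared by cutting a whole walk into homogeneous parts. The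
    walk has n - d steps, whereas omega is defined through the Krull dimension of k[D]; hence the
    separate proof that this dimension is d. Its upper bound is a count: for d + 1 elements chosen
    along a chain of primes, a polynomial relation has more coefficients to choose than monomials to
    cancel. *)

Section MpolyForm.
Variables (k : fieldType) (n : nat).
Implicit Types (u v : 'X_{1..n} -> k) (p q : {mpoly k[n]}).

(** The linear form on polynomials with value [u m] at the monomial [m]. The coefficients of
    [p *: f] in a Cousin term are values of such forms at [p]. *)
Definition mform u p : k := \sum_(m <- msupp p) p@_m * u m.

Lemma mformwE u p w : (msize p <= w)%N ->
  mform u p = \sum_(m : 'X_{1..n < w}) p@_m * u m.
Proof.
move=> le_pw; pose I : subFinType _ := 'X_{1..n < w}.
rewrite /mform (big_mksub I) ?msupp_uniq //=; last first.
  by move=> x /msize_mdeg_lt /leq_trans; apply.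
by rewrite big_rmcond //= => i /memN_msupp_eq0 ->; rewrite mul0r.
Qed.

Lemma eq_mform u v p : {in msupp p, u =1 v} -> mform u p = mform v p.
Proof. by move=> uv; apply: eq_big_seq => m /uv ->. Qed.

Lemma mform0 u : mform u 0 = 0.
Proof. by rewrite /mform msupp0 big_nil. Qed.

Lemma mformD u p q : mform u (p + q) = mform u p + mform u q.
Proof.
pose w := maxn (msize (p + q)) (maxn (msize p) (msize q)).
rewrite !(@mformwE u _ w) ?leq_max ?leqnn ?orbT // -big_split /=.
by apply: eq_bigr => m _; rewrite mcoeffD mulrDl.
Qed.

Lemma mformZX u c m : mform u (c *: 'X_[m]) = c * u m.
Proof.
have [->|c0] := eqVneq c 0; first by rewrite scale0r mform0 mul0r.
by rewrite /mform msuppMCX // big_seq1 mcoeffZ mcoeffX eqxx mulr1.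
Qed.

Lemma mformX u m : mform u 'X_[m] = u m.
Proof. by rewrite -['X_[m]]scale1r mformZX mul1r. Qed.

Lemma mform_fun0 p : mform (fun=> 0) p = 0.
Proof. by rewrite /mform big1 // => m _; rewrite mulr0. Qed.

Lemma mform_funD u v p :
  mform (fun m => u m + v m) p = mform u p + mform v p.
Proof. by rewrite -big_split; apply: eq_bigr => m _; rewrite mulrDr. Qed.

Lemma mform_funZ c u p : mform (fun m => c * u m) p = c * mform u p.
Proof. by rewrite mulr_sumr; apply: eq_bigr => m _; rewrite mulrCA. Qed.

Lemma mform_fun_sum (I : finType) (P : pred I) (u : I -> 'X_{1..n} -> k) p :
  mform (fun m => \sum_(i | P i) u i m) p = \sum_(i | P i) mform (u i) p.
Proof.
by rewrite exchange_big /=; apply: eq_bigr => m _; rewrite mulr_sumr.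
Qed.

Lemma mformM u p q :
  mform u (p * q) = mform (fun m => mform (fun m' => u (m + m')%MM) q) p.
Proof.
elim/mpolyind: p => [|c m p _ _ IH]; first by rewrite mul0r !mform0.
rewrite mulrDl !mformD IH mformZX; congr (_ + _).
elim/mpolyind: q {IH} => [|c' m' q _ _ IH]; first by rewrite mulr0 !mform0 mulr0.
rewrite mulrDr !mformD IH mulrDr mformZX; congr (_ + _).
by rewrite -scalerAl -scalerAr scalerA -mpolyXD mformZX mulrA.
Qed.

End MpolyForm.

Section Exponents.
Variable n : nat.
Implicit Types (a b : {ffun 'I_n -> int}) (S T : {set 'I_n}) (m : 'X_{1..n}).

Definition pos a : {set 'I_n} := [set i | 0 < a i].
Definition tdeg a : int := \sum_i a i.
Definition mexp m : {ffun 'I_n -> int} := [ffun i => (m i)%:Z].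
Definition ind T : {ffun 'I_n -> int} := [ffun i => (i \in T)%:Z].
Definition mnm_ind T : 'X_{1..n} := [multinom nat_of_bool (i \in T) | i < n].
Definition msup m : {set 'I_n} := [set i | m i != 0%N].

Lemma mexpD m m' : mexp (m + m')%MM = mexp m + mexp m'.
Proof. by apply/ffunP => i; rewrite !ffunE mnmDE PoszD. Qed.

Lemma mexp0 : mexp 0%MM = 0.
Proof. by apply/ffunP => i; rewrite !ffunE mnm0E. Qed.

Lemma mexp_inj : injective mexp.
Proof. by move=> m m' /ffunP e; apply/mnmP => i; move: (e i); rewrite !ffunE => -[]. Qed.

Lemma mexp_ind T : mexp (mnm_ind T) = ind T.
Proof. by apply/ffunP => i; rewrite !ffunE mnmE. Qed.

Lemma tdegD a b : tdeg (a + b) = tdeg a + tdeg b.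
Proof. by rewrite -big_split; apply: eq_bigr => i _; rewrite ffunE. Qed.

Lemma tdegN a : tdeg (- a) = - tdeg a.
Proof. by rewrite -sumrN; apply: eq_bigr => i _; rewrite ffunE. Qed.

Lemma tdegB a b : tdeg (a - b) = tdeg a - tdeg b.
Proof. by rewrite tdegD tdegN. Qed.

Lemma tdeg_mexp m : tdeg (mexp m) = (mdeg m)%:Z.
Proof. by rewrite /tdeg mdegE -!natz natr_sum; apply: eq_bigr => i _; rewrite ffunE natz. Qed.

Lemma pos_mexp m : pos (mexp m) = msup m.
Proof. by apply/setP => i; rewrite !inE ffunE; lia. Qed.

Lemma pos_subm a m : pos (a - mexp m) \subset pos a.
Proof. apply/subsetP => i; rewrite !inE !ffunE. move: (a i) (m i) => x y. lia. Qed.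

Lemma pos_add_ind a T S : T \subset S -> (pos (a + ind T) \subset S) = (pos a \subset S).
Proof.
move=> /subsetP TS; apply/subsetP/subsetP => sub i; last first.
  rewrite !inE !ffunE; case: (boolP (i \in T)) => [/TS //|_].
  by rewrite addr0 => h; apply: sub; rewrite inE.
rewrite inE => h; case: (boolP (i \in T)) => [/TS //|iT].
by apply: sub; rewrite !inE !ffunE (negbTE iT) addr0.
Qed.

Lemma msup_ind T : msup (mnm_ind T) = T.
Proof. by apply/setP => i; rewrite !inE mnmE; case: (i \in T). Qed.

Lemma mdeg_ind T : mdeg (mnm_ind T) = #|T|.
Proof.
rewrite mdegE -sum1_card [RHS]big_mkcond /=.
by apply: eq_bigr => i _; rewrite mnmE; case: (i \in T).
Qed.

End Exponents.

Arguments mexp_inj {n}.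

(** * The terms of the Cousin complex and the action of polynomials *)

Section CousinModule.
Variables (k : fieldType) (n : nat).
Local Notation R := {mpoly k[n]}.
Local Notation expo := {ffun 'I_n -> int}.

(* [f S a] is the coefficient of the Laurent monomial of exponent [a] in the
   summand indexed by [S]. The twist by [-n] is absorbed in the exponents, hence
   the support condition [a i <= 0], rather than [a i < 0], for [i] outside [S].
   The supports may be infinite, but the total degree is bounded above: this is
   all that is needed to recover polynomials in [embed_surj]. *)
Definition cousin_axiom (f : {set 'I_n} -> expo -> k) : Prop :=
  (forall (S : {set 'I_n}) (a : expo), ~~ (pos a \subset S) -> f S a = 0) /\
  exists B : int, forall S a, B < tdeg a -> f S a = 0.

Record cousin := Cousin {
  cousin_val :> {set 'I_n} -> expo -> k;
  cousinP : cousin_axiom cousin_val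
}.

HB.instance Definition _ := gen_eqMixin cousin.
HB.instance Definition _ := gen_choiceMixin cousin.

Implicit Types (f g : cousin) (p q : R) (S T : {set 'I_n}) (a : expo).

Lemma cousin_supp f S a : ~~ (pos a \subset S) -> f S a = 0.
Proof. by case: f => f [h1 h2] /= /h1. Qed.

Lemma cousin_eq f g : (forall S a, pos a \subset S -> f S a = g S a) -> f = g.
Proof.
move=> fg; have : cousin_val f = cousin_val g.
  apply/funext => S; apply/funext => a; case: (boolP (pos a \subset S)) => [/fg //|h].
  by rewrite !cousin_supp.
case: f g {fg} => [f hf] [g hg] /= e; rewrite -e in hg *; congr Cousin.
exact: Prop_irrelevance.
Qed.

Lemma cousin0_axiom : cousin_axiom (fun _ _ => 0).
Proof. by split=> //; exists 0. Qed.
Definition cousin0 := Cousin cousin0_axiom.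

Lemma cousinN_axiom f : cousin_axiom (fun S a => - f S a).
Proof.
case: f => f [h1 [B h2]] /=; split=> [S a /h1 -> |]; rewrite ?oppr0 //.
by exists B => S a /h2 ->; rewrite oppr0.
Qed.
Definition cousinN f := Cousin (cousinN_axiom f).

Lemma cousinD_axiom f g : cousin_axiom (fun S a => f S a + g S a).
Proof.
case: f g => f [h1 [B h2]] [g [h1' [B' h2']]] /=.
split=> [S a h|]; first by rewrite h1 // h1' // addr0.
exists (Num.max B B') => S a; rewrite gt_max => /andP[hB hB'].
by rewrite h2 // h2' // addr0.
Qed.
Definition cousinD f g := Cousin (cousinD_axiom f g).

Lemma cousin_addA : associative cousinD.
Proof. by move=> f g h; apply: cousin_eq => S a _ /=; rewrite addrA. Qed.
Lemma cousin_addC : commutative cousinD.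
Proof. by move=> f g; apply: cousin_eq => S a _ /=; rewrite addrC. Qed.
Lemma cousin_add0 : left_id cousin0 cousinD.
Proof. by move=> f; apply: cousin_eq => S a _ /=; rewrite add0r. Qed.
Lemma cousin_addN : left_inverse cousin0 cousinN cousinD.
Proof. by move=> f; apply: cousin_eq => S a _ /=; rewrite addNr. Qed.

HB.instance Definition _ :=
  GRing.isZmodule.Build cousin cousin_addA cousin_addC cousin_add0 cousin_addN.

Lemma cousin0E S a : (0 : cousin) S a = 0. Proof. by []. Qed.
Lemma cousinDE f g S a : (f + g) S a = f S a + g S a. Proof. by []. Qed.
Lemma cousinBE f g S a : (f - g) S a = f S a - g S a. Proof. by []. Qed.

Lemma cousin_sumE (I : Type) (r : seq I) (P : pred I) (f : I -> cousin) S a :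
  (\sum_(i <- r | P i) f i) S a = \sum_(i <- r | P i) f i S a.
Proof. by elim/big_rec2: _ => // i x y _ <-. Qed.

(** Each coefficient of the product is a finite sum over the monomials of [p]. Exponents pushed out
    of the support condition are truncated, as for k[x^-1] seen as the quotient of k[x, x^-1] by x
    k[x]. *)
Lemma cousinZ_axiom p f : cousin_axiom (fun S a =>
  if pos a \subset S then mform (fun m => f S (a - mexp m)) p else 0).
Proof.
split=> [S a /negbTE -> //|]; case: f => f [h1 [B h2]] /=.
exists (B + (msize p)%:Z) => S a lt_a; case: ifP => // _.
rewrite /mform big_seq big1 // => m /msize_mdeg_lt lt_m.
by rewrite h2 ?mulr0 // tdegB tdeg_mexp; lia.
Qed.
Definition cousinZ p f := Cousin (cousinZ_axiom p f).

Lemma cousin_scaleA p q f : cousinZ p (cousinZ q f) = cousinZ (p * q) f.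
Proof.
apply: cousin_eq => S a aS /=; rewrite aS mformM; apply: eq_mform => m _.
rewrite (subset_trans (pos_subm _ _) aS); apply: eq_mform => m' _.
by rewrite mexpD opprD addrA.
Qed.

Lemma cousin_scale1 : left_id 1 cousinZ.
Proof.
move=> f; apply: cousin_eq => S a aS /=.
by rewrite aS -mpolyX0 mformX mexp0 subr0.
Qed.

Lemma cousin_scaleDr : right_distributive cousinZ +%R.
Proof.
by move=> p f g; apply: cousin_eq => S a aS; rewrite cousinDE /= aS mform_funD.
Qed.

Lemma cousin_scaleDl f : {morph cousinZ^~ f : p q / p + q}.
Proof. by move=> p q; apply: cousin_eq => S a aS; rewrite cousinDE /= aS mformD. Qed.

HB.instance Definition _ := GRing.Zmodule_isLmodule.Build R cousin
  cousin_scaleA cousin_scale1 cousin_scaleDr cousin_scaleDl.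

Lemma cousinZE p f S a : pos a \subset S ->
  (p *: f) S a = mform (fun m => f S (a - mexp m)) p.
Proof. by rewrite /GRing.scale /= => ->. Qed.

Lemma cousinXE m f S a : pos a \subset S -> ('X_[m] *: f) S a = f S (a - mexp m).
Proof. by move=> aS; rewrite cousinZE // mformX. Qed.

Lemma comp_axiom (P : pred {set 'I_n}) f :
  cousin_axiom (fun S a => if P S then f S a else 0).
Proof.
case: f => f [h1 [B h2]] /=; split=> [S a /h1 -> |]; first by rewrite if_same.
by exists B => S a /h2 ->; rewrite if_same.
Qed.
Definition comp P f := Cousin (comp_axiom P f).

Lemma compE P f S a : comp P f S a = if P S then f S a else 0. Proof. by []. Qed.

Lemma homc_axiom (j : int) f :
  cousin_axiom (fun S a => if tdeg a == j then f S a else 0).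
Proof.
case: f => f [h1 [B h2]] /=; split=> [S a /h1 -> |]; first by rewrite if_same.
by exists B => S a /h2 ->; rewrite if_same.
Qed.
Definition homc j f := Cousin (homc_axiom j f).

Lemma homcE j f S a : homc j f S a = if tdeg a == j then f S a else 0.
Proof. by []. Qed.

Lemma homc_linear0 j : zmod_morphism (homc j).
Proof.
move=> f g; apply: cousin_eq => S a _; rewrite cousinBE /= .
by case: ifP; rewrite ?subr0 // cousinBE.
Qed.
HB.instance Definition _ j :=
  GRing.isZmodMorphism.Build cousin cousin (homc j) (homc_linear0 j).

Lemma homcZ d j p f : p \is d.-homog -> homc (d%:Z + j) (p *: f) = p *: homc j f.
Proof.
move=> /dhomogP hp; apply: cousin_eq => S a aS; rewrite [LHS]/= !cousinZE //=.
transitivity (mform (fun m => if tdeg a == d%:Z + j then f S (a - mexp m) else 0) p).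
  by rewrite aS; case: ifP => // _; rewrite mform_fun0.
apply: eq_mform => m /hp dm; rewrite tdegB tdeg_mexp dm.
by rewrite subr_eq addrC.
Qed.

(** On the summand of [T] the exponents at the elements of [T] are unrestricted, so multiplication
    by x_T is bijective there; this is the projection to that summand followed by the inverse. *)
Lemma invc_axiom T f :
  cousin_axiom (fun S a => if S == T then f T (a + ind T) else 0).
Proof.
case: f => f [h1 [B h2]] /=; split=> [S a h |].
  by case: eqP h => // -> h; rewrite h1 // pos_add_ind.
exists B => S a lt_a; case: eqP => // _; rewrite h2 // tdegD -mexp_ind tdeg_mexp.
lia.
Qed.
Definition invc T f := Cousin (invc_axiom T f).

Lemma invcE T f S a : invc T f S a = if S == T then f T (a + ind T) else 0.
Proof. by []. Qed.

Lemma invc_linear T : linear (invc T).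
Proof.
move=> p f g; apply: cousin_eq => S a aS; rewrite cousinDE cousinZE // !invcE.
under eq_mform do rewrite invcE.
case: eqP aS => [->|_] aT; last by rewrite mform_fun0 addr0.
rewrite cousinDE cousinZE ?pos_add_ind //; congr (_ + _).
by apply: eq_mform => m _; rewrite addrAC.
Qed.
HB.instance Definition _ T :=
  GRing.isLinear.Build R cousin cousin *:%R (invc T) (invc_linear T).

Lemma invcK T f : 'X_[mnm_ind T] *: invc T f = comp (pred1 T) f.
Proof.
apply: cousin_eq => S a aS; rewrite cousinXE // invcE compE mexp_ind /=.
by case: eqP => // ->; rewrite subrK.
Qed.

Lemma comp_linear P : linear (comp P).
Proof.
move=> p f g; apply: cousin_eq => S a aS; rewrite cousinDE cousinZE // !compE.
under eq_mform do rewrite compE.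
case: ifP => _; last by rewrite mform_fun0 addr0.
by rewrite cousinDE cousinZE.
Qed.
HB.instance Definition _ P :=
  GRing.isLinear.Build R cousin cousin *:%R (comp P) (comp_linear P).

Definition level (t : nat) f := forall S a, #|S| != t -> f S a = 0.

Lemma levelD t f g : level t f -> level t g -> level t (f + g).
Proof. by move=> lf lg S a h; rewrite cousinDE lf // lg // addr0. Qed.

Lemma levelZ t p f : level t f -> level t (p *: f).
Proof.
move=> lf S a h; case: (boolP (pos a \subset S)) => aS; last by rewrite cousin_supp.
by rewrite cousinZE // -[RHS](mform_fun0 p); apply: eq_mform => m _; rewrite lf.
Qed.

Lemma levelB t f g : level t f -> level t g -> level t (f - g).
Proof. by move=> lf lg; rewrite -scaleN1r; apply: levelD => //; apply: levelZ. Qed.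

Lemma level_sum t (I : finType) (f : I -> cousin) :
  (forall i, level t (f i)) -> level t (\sum_i f i).
Proof. by move=> lf; apply: big_ind => // x y; apply: levelD. Qed.

Lemma level_invc T f : level #|T| (invc T f).
Proof. by move=> S a; rewrite invcE; case: (S =P T) => // ->; rewrite eqxx. Qed.

Lemma level_comp t f : level t f ->
  f = \sum_(T : {set 'I_n} | #|T| == t) comp (pred1 T) f.
Proof.
move=> lf; apply: cousin_eq => S a _; rewrite cousin_sumE /=.
have [St|/lf ->] := eqVneq #|S| t; last first.
  by rewrite big1 // => T Tt; case: eqP => // e; rewrite e lf // -e (eqP Tt) eqxx.
rewrite (bigD1 S) ?St //= eqxx big1 ?addr0 // => T /andP[_ ST].
by rewrite eq_sym (negbTE ST).
Qed.

Lemma level_homc t j f : level t f -> level t (homc j f).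
Proof. by move=> lf S a h /=; rewrite lf // if_same. Qed.

End CousinModule.

Arguments cousin_val {k n} _ _ _ : simpl never.

(** * The differential, its exactness, and R(-n) as the kernel at level n *)

Section CousinDifferential.
Variables (k : fieldType) (n : nat).
Local Notation R := {mpoly k[n]}.
Local Notation expo := {ffun 'I_n -> int}.
Local Notation cousin := (cousin k n).
Implicit Types (f g : cousin) (p q : R) (S T : {set 'I_n}) (a : expo).

Definition sgn (v : 'I_n) S : k := (-1) ^+ #|[set u in S | (u < v)%N]|.

Lemma sgnK v S : sgn v S * sgn v S = 1.
Proof. by rewrite -expr2 sqrr_sign. Qed.

Lemma sgnU u v S : u \notin S -> sgn v (u |: S) = (-1) ^+ (u < v)%N * sgn v S.
Proof.
move=> uS; rewrite /sgn -exprD; congr (_ ^+ _); case: ltnP => uv.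
  rewrite (_ : [set w in u |: S | (w < v)%N] = u |: [set w in S | (w < v)%N]).
    by rewrite cardsU1 inE (negbTE uS).
  by apply/setP => w; rewrite !inE; case: eqP => // ->; rewrite uv.
congr #|pred_of_set _|; apply/setP => w; rewrite !inE.
by case: eqP => //= ->; rewrite ltnNge uv andbF.
Qed.

(** In a fixed exponent [a], the sets containing [pos a] are the faces of the full simplex on the
    complement of [pos a], and [delta] is its boundary map up to signs. The test on [pos a]
    truncates the Laurent monomials that vanish in the summand of [T]. *)
Lemma delta_axiom f : cousin_axiom (fun T a =>
  if pos a \subset T then \sum_(v | v \notin T) sgn v T * f (v |: T) a else 0).
Proof.
split=> [T a /negbTE -> //|]; have [h1 [B h2]] := cousinP f.
exists B => T a lt_a; case: ifP => // _.
by rewrite big1 // => v _; rewrite h2 // mulr0.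
Qed.
Definition delta f := Cousin (delta_axiom f).

Lemma deltaE f T a : pos a \subset T ->
  delta f T a = \sum_(v | v \notin T) sgn v T * f (v |: T) a.
Proof. by rewrite /delta /cousin_val => ->. Qed.

Lemma delta_linear : linear delta.
Proof.
move=> p f g; apply: cousin_eq => T a aT; rewrite cousinDE cousinZE // !deltaE //.
under eq_mform do rewrite deltaE ?(subset_trans (pos_subm _ _) aT) //.
rewrite mform_fun_sum -big_split /=; apply: eq_bigr => v _.
have aT' : pos a \subset v |: T by rewrite (subset_trans aT) ?subsetUr.
by rewrite cousinDE cousinZE // mulrDr mform_funZ.
Qed.
HB.instance Definition _ :=
  GRing.isLinear.Build R cousin cousin *:%R delta delta_linear.

Lemma deltaP p f g : delta (p *: f + g) = p *: delta f + delta g.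
Proof. exact: linearP. Qed.

Lemma deltaZ p f : delta (p *: f) = p *: delta f.
Proof. exact: linearZ. Qed.

Lemma delta_sum (I : finType) (f : I -> cousin) :
  delta (\sum_i f i) = \sum_i delta (f i).
Proof. exact: linear_sum. Qed.

Lemma level_delta t f : level t.+1 f -> level t (delta f).
Proof.
move=> lf T a h; have [aT|aT] := boolP (pos a \subset T); last by rewrite cousin_supp.
rewrite deltaE // big1 // => v vT; rewrite lf ?mulr0 //.
by rewrite cardsU1 vT.
Qed.

Lemma delta_homc j f : delta (homc j f) = homc j (delta f).
Proof.
apply: cousin_eq => T a aT; rewrite homcE !deltaE //.
case: eqP => [e|ne]; first by apply: eq_bigr => v _; rewrite homcE e eqxx.
by rewrite big1 // => v _; rewrite homcE; case: eqP; rewrite // mulr0.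
Qed.

Lemma deltaK f : delta (delta f) = 0.
Proof.
apply: cousin_eq => T a aT; rewrite deltaE // cousin0E.
pose G (v u : 'I_n) := sgn v T * sgn u T * f (u |: (v |: T)) a.
have GC v u : G v u = G u v by rewrite /G setUCA [sgn v T * _]mulrC.
transitivity (\sum_(v | v \notin T)
   (\sum_(u | (u \notin T) && (u < v)%N) G v u -
    \sum_(u | (u \notin T) && (v < u)%N) G v u)).
  apply: eq_bigr => v vT; rewrite deltaE ?(subset_trans aT) ?subsetUr //.
  rewrite mulr_sumr (bigID (fun u : 'I_n => (u < v)%N)) /= -sumrN; congr (_ + _).
    apply: eq_big => [u|u /andP[_ uv]].
      by rewrite !inE; case: ltngtP => //= e; rewrite ?andbT ?andbF //;
         case: eqP e => //= ->; rewrite ltnn.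
    by rewrite sgnU // [(v < u)%N]ltnNge ltnW //= mul1r /G !mulrA.
  apply: eq_big => [u|u /andP[uv' uv]].
    rewrite !inE; case: (ltngtP u v) => // e; rewrite ?andbT ?andbF //.
      by case: eqP e => // ->; rewrite ltnn.
    by rewrite (val_inj e) eqxx.
  have {}uv : (v < u)%N.
    by move: uv'; rewrite !inE negb_or => /andP[ne _]; rewrite ltn_neqAle leqNgt uv andbT eq_sym.
  by rewrite sgnU // uv expr1 mulN1r mulNr mulrN /G !mulrA.
rewrite sumrB; apply/eqP; rewrite subr_eq0; apply/eqP.
rewrite (exchange_big_dep (fun u => u \notin T)) /=; last by move=> v u _ /andP[].
apply: eq_bigr => u uT; apply: eq_big => [v|v _]; last exact: GC.
by rewrite uT.
Qed.

(* Contracting homotopy in the degree [a]: cone over a vertex outside [pos a]. *)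
Lemma htp_axiom f : cousin_axiom (fun S a =>
  if [pick v | v \notin pos a] is Some v then
    if v \in S then sgn v S * f (S :\ v) a else 0
  else 0).
Proof.
split=> [S a aS|].
  case: pickP => // v va; case: ifP => // vS; rewrite cousin_supp ?mulr0 //.
  by apply: contraNN aS => /subset_trans; apply; apply: subD1set.
have [h1 [B h2]] := cousinP f; exists B => S a lt_a.
by case: pickP => // v va; case: ifP => // vS; rewrite h2 ?mulr0.
Qed.
Definition htp f := Cousin (htp_axiom f).

Lemma htpE f S a : htp f S a =
  if [pick v | v \notin pos a] is Some v then
    if v \in S then sgn v S * f (S :\ v) a else 0
  else 0.
Proof. by []. Qed.

Lemma level_htp t f : level t f -> level t.+1 (htp f).
Proof.
move=> lf S a h; rewrite htpE; case: pickP => // v va; case: ifP => // vS.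
by rewrite lf ?mulr0 //; apply: contraNneq h => <-; rewrite (cardsD1 v) vS.
Qed.

(** The full simplex on the complement of [pos a] is acyclic unless this complement is empty; in
    that case the only set containing [pos a] has n elements, which [t < n] rules out. *)
Lemma delta_exact t f : (t < n)%N -> level t f -> delta f = 0 ->
  delta (htp f) = f.
Proof.
move=> tn lf df; apply: cousin_eq => T a aT.
have [Tt|Tt] := eqVneq #|T| t; last by rewrite lf // (level_delta (level_htp lf)).
rewrite deltaE //; under eq_bigr do rewrite htpE; case: pickP => [v va|/= all_pos]; last first.
  have : [set: 'I_n] \subset T.
    by apply: subset_trans aT; apply/subsetP => v _; apply/negbNE; rewrite all_pos.
  by rewrite subTset => /eqP T1; move: tn; rewrite -Tt T1 cardsT card_ord ltnn.
have [vT|vT] := boolP (v \in T); last first.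
  rewrite (bigD1 v) //= setU11 setU1K // sgnU // ltnn mul1r mulrA sgnK mul1r.
  rewrite big1 ?addr0 // => u /andP[uT uv].
  by rewrite !inE eq_sym (negbTE uv) (negbTE vT) mulr0.
(* The cycle condition at [T :\ v] expresses [f T a] through the sets [u |: (T :\ v)], exactly those
   at which the cone over [v] is evaluated. *)
have aTv : pos a \subset T :\ v by rewrite subsetD1 aT.
have /eqP : delta f (T :\ v) a = 0 by rewrite df.
rewrite deltaE // (bigD1 v) ?setD11 //= setD1K // addrC addr_eq0 => /eqP e.
have -> : f T a = - (sgn v (T :\ v) * (- (sgn v (T :\ v) * f T a))).
  by rewrite mulrN opprK mulrA sgnK mul1r.
rewrite -e mulr_sumr -sumrN; apply: eq_big => [u|u uT].
  by rewrite !inE; case: eqP => [->|]; rewrite ?vT //= andbT.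
have uv : u != v by apply: contraNneq uT => ->.
have vTv : v \notin T :\ v by rewrite setD11.
have uTv : u \notin T :\ v by rewrite !inE negb_and uT orbT.
rewrite !inE vT orbT; have -> : (u |: T) :\ v = u |: (T :\ v).
  by apply/setP => w; rewrite !inE; case: (w =P u) => // ->; rewrite uv.
rewrite sgnU // -{1 2}(setD1K vT) !sgnU // !mulrA -mulNr; congr (_ * _).
rewrite -!mulrN; case: (ltngtP u v) uv => [uv|uv|/val_inj ->] //=; rewrite ?eqxx // ltnn.
  by move=> _; rewrite !(expr0, expr1, mul1r, mulr1, mulN1r, mulrN1, mulrN, mulNr) mulrC.
by move=> _; rewrite !(expr0, expr1, mul1r, mulr1, mulN1r, mulrN1, mulrN, mulNr) mulrC.
Qed.

(** Inverse of the shift by one in every variable that the twist by -n imposes. It is meaningful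
    only when all entries of [a] are positive; [embed] masks the other values. *)
Definition mon a : 'X_{1..n} := [multinom absz (a i - 1) | i < n].

Lemma monK (m : 'X_{1..n}) : mon (mexp m + ind setT) = m.
Proof. by apply/mnmP => i; rewrite mnmE !ffunE inE /= addrK. Qed.

Lemma mexp_mon a : pos a = setT -> mexp (mon a) + ind setT = a.
Proof.
move=> aT; apply/ffunP => i; rewrite !ffunE mnmE inE /=.
have : i \in pos a by rewrite aT inE.
by rewrite inE; move: (a i) => x; lia.
Qed.

Lemma pos_mexp_ind (m : 'X_{1..n}) : pos (mexp m + ind setT) = setT.
Proof. by apply/setP => i; rewrite !inE !ffunE inE /=; lia. Qed.

(* [p] in R(-n): the monomial of exponent [m] goes to the exponent [m + 1]. *)
Lemma embed_axiom p : cousin_axiom (fun S a =>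
  if (S == setT) && (pos a == setT) then p@_(mon a) else 0).
Proof.
split=> [S a|]; first by case: (S =P _) => // ->; rewrite subsetT.
exists ((msize p + n)%N%:Z) => S a lt_a; case: ifP => // /andP[_ /eqP aT].
apply: memN_msupp_eq0; apply: contraTN lt_a => /msize_mdeg_lt.
rewrite -leNgt -{2}(mexp_mon aT) tdegD tdeg_mexp -mexp_ind tdeg_mexp mdeg_ind.
by rewrite cardsT card_ord; lia.
Qed.
Definition embed (p : R^o) : cousin := Cousin (embed_axiom p).

Lemma embedE p (m : 'X_{1..n}) : embed p setT (mexp m + ind setT) = p@_m.
Proof. by rewrite /embed /cousin_val pos_mexp_ind !eqxx /= monK. Qed.

Lemma embed_out p S a : ~~ ((S == setT) && (pos a == setT)) -> embed p S a = 0.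
Proof. by rewrite /embed /cousin_val => /negbTE ->. Qed.

Lemma mcoeff_mform p m : p@_m = mform (fun m' => (m' == m)%:R) p.
Proof.
rewrite {1}[p]mpolyE raddf_sum; apply: eq_bigr => m' _.
by rewrite /= mcoeffZ mcoeffX.
Qed.

Lemma embed_linear : linear embed.
Proof.
move=> p q r; apply: cousin_eq => S a aS; rewrite cousinDE cousinZE //.
have [/andP[/eqP -> /eqP aT]|h] := boolP ((S == setT) && (pos a == setT)); last first.
  rewrite !embed_out // addr0 -[LHS](mform_fun0 p); apply: eq_mform => m _.
  rewrite embed_out //; apply: contraNN h => /andP[/eqP -> /eqP aT].
  by rewrite eqxx -subTset -aT pos_subm.
rewrite -(mexp_mon aT) !embedE mcoeffD; congr (_ + _).
rewrite [_ *: _]/(p * q) mcoeff_mform mformM; apply: eq_mform => m _.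
set m0 := mon a; have [le_m|nle_m] := boolP (m <= m0)%MM.
  have -> : mexp m0 + ind setT - mexp m = mexp (m0 - m)%MM + ind setT.
    by rewrite -{1}(submK le_m) mexpD addrAC addrK.
  rewrite embedE mcoeff_mform; apply: eq_mform => m' _.
  by rewrite -{1}(submK le_m) addmC eqm_add2r.
rewrite embed_out; last first.
  apply: contraNN nle_m => /andP[_ /eqP e]; apply/mnm_lepP => i.
  have : i \in pos (mexp m0 + ind setT - mexp m) by rewrite e inE.
  by rewrite !inE !ffunE inE /=; lia.
rewrite -[RHS](mform_fun0 q); apply: eq_mform => m' _.
by case: eqP nle_m => // <-; rewrite lem_addr.
Qed.
HB.instance Definition _ :=
  GRing.isLinear.Build R R^o cousin *:%R embed embed_linear.

Lemma embed_inj : injective embed.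
Proof. by move=> p q e; apply/mpolyP => m; rewrite -!embedE e. Qed.

Lemma level_embed p : level n (embed p).
Proof.
move=> S a h; rewrite embed_out //; apply: contraNN h => /andP[/eqP -> _].
by rewrite cardsT card_ord.
Qed.

Lemma delta_embed p : delta (embed p) = 0.
Proof.
apply: cousin_eq => T a aT; rewrite deltaE // big1 // => v vT.
rewrite embed_out ?mulr0 //; apply: contraNN vT => /andP[_ /eqP e].
by apply: (subsetP aT); rewrite e.
Qed.

(** The cycle condition confines [f] to exponents with all entries positive, and the bound on the
    total degree then leaves finitely many monomials. *)
Lemma embed_surj f : level n f -> delta f = 0 -> exists p, embed p = f.
Proof.
move=> lf df; have [B hB] := (cousinP f).2.
exists (\sum_(m : 'X_{1..n < `|B|.+1}) f setT (mexp m + ind setT) *: 'X_[m]).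
apply: cousin_eq => S a aS.
have [ST|ST] := eqVneq S setT; last first.
  rewrite embed_out ?(negbTE ST) // lf //; apply: contraNN ST => /eqP.
  by move=> e; rewrite eqEcard subsetT cardsT card_ord e leqnn.
rewrite {}ST in aS *; have [aT|aT] := eqVneq (pos a) setT.
  rewrite -(mexp_mon aT) embedE; set m := mon a.
  have [lt_m|le_m] := ltnP (mdeg m) `|B|.+1.
    by rewrite (mcoeff_mpoly (fun m => f setT (mexp m + ind setT))).
  rewrite hB; last by rewrite tdegD -mexp_ind !tdeg_mexp; lia.
  rewrite raddf_sum big1 //= => -[m' lt_m'] _; rewrite mcoeffZ mcoeffX /=.
  by case: eqP lt_m' le_m => [->|]; rewrite ?mulr0 // => h; rewrite leqNgt h.
rewrite embed_out ?(negbTE aT) ?andbF //.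
(* For [v] outside [pos a], the differential at the complement of [v] has a single term, which is
   [f setT a] up to sign. *)
have /subsetPn[v _ va] : ~~ ([set: 'I_n] \subset pos a) by rewrite subTset.
have : delta f (~: [set v]) a = 0 by rewrite df.
rewrite deltaE; last by rewrite subsetC sub1set inE.
rewrite (bigD1 v) ?inE ?negbK //= big1 => [|u]; last first.
  by rewrite !inE negbK => /andP[->].
by rewrite addr0 setUCr => /eqP; rewrite mulf_eq0 signr_eq0 => /eqP.
Qed.

Definition graded j f := homc j f = f.

Lemma homcK j f : graded j (homc j f).
Proof. by apply: cousin_eq => S a _; rewrite !homcE; case: (_ == _). Qed.

Lemma gradedP j f : graded j f <-> forall S a, f S a != 0 -> tdeg a = j.
Proof.
split=> [<- S a|h]; first by rewrite homcE; case: (tdeg a =P j) => // _; rewrite eqxx.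
apply: cousin_eq => S a _; rewrite homcE; case: eqP => // ne.
by apply/esym/eqP/negbNE/negP => /h.
Qed.

Lemma mpoly_pieceP i p : mpoly_piece i p <-> forall m, p@_m != 0 -> (mdeg m)%:Z = i.
Proof.
case: i => d /=; split.
- by move=> /dhomogP h m; rewrite -mcoeff_msupp => /h ->.
- by move=> h; apply/dhomogP => m; rewrite mcoeff_msupp => /h [].
- by move=> -> m; rewrite mcoeff0 eqxx.
by move=> h; apply/mpolyP => m; rewrite mcoeff0; apply/eqP/negbNE/negP => /h.
Qed.

Lemma graded_embed j p : graded j (embed p) <-> mpoly_piece (- n%:Z + j) p.
Proof.
have tdegT m : tdeg (mexp m + ind [set: 'I_n]) = (mdeg m)%:Z + n%:Z.
  by rewrite tdegD tdeg_mexp -mexp_ind tdeg_mexp mdeg_ind cardsT card_ord.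
rewrite mpoly_pieceP gradedP; split=> h.
  by move=> m; rewrite -embedE => /h; rewrite tdegT => <-; rewrite addrC addrK.
move=> S a; have [/andP[/eqP -> /eqP aT]|o] := boolP ((S == setT) && (pos a == setT)).
  by rewrite -(mexp_mon aT) embedE tdegT => /h ->; rewrite addrC addNKr.
by rewrite embed_out ?eqxx.
Qed.

Lemma homc_pieceZ i j p f : mpoly_piece i p -> homc (i + j) (p *: f) = p *: homc j f.
Proof. by case: i => d; [apply: homcZ | move=> /= ->; rewrite !scale0r raddf0]. Qed.

End CousinDifferential.

(** * Resolutions and dimension shifting *)

Section Cochains.
Variables (k : fieldType) (n : nat).
Local Notation R := {mpoly k[n]}.
Variables (M : gmod R) (F : gresolution M).
Implicit Type N : lmodType R.

Definition coch N i : lmodType R := {ffun 'I_(gres_rank F i) -> N}.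

Definition cod N i : {linear coch N i -> coch N i.+1} :=
  mxact (fun l j => gres_d j l).

Definition postcomp N N' (f : N -> N') i (z : coch N i) : coch N' i :=
  [ffun l => f (z l)].

Lemma codE N i (z : coch N i) j : cod N i z j = \sum_l gres_d j l *: z l.
Proof. by rewrite ffunE. Qed.

Lemma codP N i p (z z' : coch N i) :
  cod N i (p *: z + z') = p *: cod N i z + cod N i z'.
Proof. exact: linearP. Qed.

Lemma codB N i (z z' : coch N i) : cod N i (z - z') = cod N i z - cod N i z'.
Proof. exact: linearB. Qed.

Lemma cod_postcomp N N' (f : {linear N -> N'}) i (z : coch N i) :
  cod N' i (postcomp f z) = postcomp f (cod N i z).
Proof.
apply/ffunP => j; rewrite codE ffunE codE linear_sum.
by apply: eq_bigr => l _; rewrite ffunE linearZ.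
Qed.

Lemma postcomp_linear N N' (f : {linear N -> N'}) i :
  linear (@postcomp N N' f i).
Proof. by move=> p z z'; apply/ffunP => l; rewrite !ffunE linearP. Qed.
HB.instance Definition _ N N' (f : {linear N -> N'}) i :=
  GRing.isLinear.Build R (coch N i) (coch N' i) *:%R (@postcomp N N' f i)
    (@postcomp_linear N N' f i).

Definition unit_row (I : finType) (i : I) : {ffun I -> R^o} := [ffun j => (j == i)%:R].

Lemma sum_unit_row (I : finType) N (i : I) (x : I -> N) :
  \sum_j unit_row i j *: x j = x i.
Proof.
rewrite (bigD1 i) //= ffunE eqxx scale1r big1 ?addr0 // => j /negbTE ji.
by rewrite ffunE ji scale0r.
Qed.

Lemma mxact_unit_row (I J : finType) (a : I -> J -> R) i :
  mxact a (unit_row i) = [ffun j => a i j : R^o].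
Proof.
apply/ffunP => j; rewrite !ffunE -[RHS](sum_unit_row i (fun i => a i j : R^o)).
by apply: eq_bigr => l _; rewrite [RHS]mulrC.
Qed.

Lemma gres_dd i (t : 'I_(gres_rank F i.+2)) (m : 'I_(gres_rank F i)) :
  \sum_l gres_d t l * gres_d l m = 0.
Proof.
have /(gres_exactS (g := F)) /ffunP/(_ m) e : exists y,
    [ffun l => gres_d t l : R^o] = mxact (@gres_d _ _ _ F i.+1) y.
  by exists (unit_row t); rewrite mxact_unit_row.
rewrite ffunE [RHS]ffunE in e; rewrite -[RHS]e.
by apply: eq_bigr => l _; rewrite ffunE [RHS]mulrC.
Qed.

Lemma codK N i (z : coch N i) : cod N i.+1 (cod N i z) = 0.
Proof.
apply/ffunP => t; rewrite codE ffunE.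
transitivity (\sum_l \sum_m (gres_d t l * gres_d l m) *: z m).
  apply: eq_bigr => l _; rewrite codE scaler_sumr.
  by apply: eq_bigr => m _; rewrite scalerA.
rewrite exchange_big big1 //= => m _.
by rewrite -scaler_suml gres_dd scale0r.
Qed.

Section Homotopy.
Variables (r : R) (rM : forall m : M, r *: m = 0).

(** As [r] kills [M], it sends the basis of F_0 into the kernel of the augmentation, which lifts to
    F_1. This is the first map of a null-homotopy of multiplication by [r]. *)
Lemma htpy0 : exists s : 'I_(gres_rank F 0) -> 'I_(gres_rank F 1) -> R,
  forall l m, \sum_j s l j * gres_d j m = r * unit_row l m.
Proof.
suff /choice[s hs] : forall l, exists y : {ffun 'I_(gres_rank F 1) -> R^o},
    r *: unit_row l = mxact (@gres_d _ _ _ F 0) y.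
  exists (fun l => s l) => l m; move/ffunP: (hs l) => /(_ m).
  rewrite ffunE => e; rewrite [RHS]e ffunE.
  by apply: eq_bigr => j _; rewrite mulrC.
move=> l; apply/gres_exact0.
rewrite -[RHS](rM (gres_aug l)) -(sum_unit_row l (@gres_aug _ _ _ F)) scaler_sumr.
by apply: eq_bigr => m _; rewrite ffunE scalerA.
Qed.

(* [d s d = r d]: the consequence of the homotopy relation [d s + s d = r] that
   suffices to continue the construction of the homotopy one step further. *)
Definition presec i (s : 'I_(gres_rank F i) -> 'I_(gres_rank F i.+1) -> R) :=
  forall t m, \sum_l gres_d t l * (\sum_j s l j * gres_d j m) = r * gres_d t m.

Lemma htpy_step i s : @presec i s ->
  exists s' : 'I_(gres_rank F i.+1) -> 'I_(gres_rank F i.+2) -> R,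
  forall t j, \sum_m s' t m * gres_d m j =
    r * unit_row t j - \sum_l gres_d t l * s l j.
Proof.
move=> hs; suff /choice[s' hs'] : forall t, exists y : {ffun 'I_(gres_rank F i.+2) -> R^o},
    [ffun j => r * unit_row t j - \sum_l gres_d t l * s l j : R^o] =
    mxact (@gres_d _ _ _ F i.+1) y.
  exists (fun l => s' l) => t j; move/ffunP: (hs' t) => /(_ j).
  rewrite !ffunE => ->; by apply: eq_bigr => m _; rewrite mulrC.
move=> t; apply/gres_exactS; apply/ffunP => m; rewrite ffunE [RHS]ffunE.
transitivity (\sum_j (r * (unit_row t j * gres_d j m) -
                 (\sum_l gres_d t l * s l j) * gres_d j m)).
  by apply: eq_bigr => j _; rewrite ffunE [LHS]mulrC mulrBl mulrA.
rewrite sumrB -mulr_sumr.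
rewrite (_ : \sum_j unit_row t j * gres_d j m = gres_d t m); last first.
  exact: (@sum_unit_row _ R^o t (fun j => gres_d j m)).
rewrite -hs; apply/eqP; rewrite subr_eq0; apply/eqP.
under [RHS]eq_bigr do rewrite mulr_suml.
rewrite exchange_big; apply: eq_bigr => l _; rewrite mulr_sumr.
by apply: eq_bigr => j _; rewrite mulrA.
Qed.

Lemma presec_step i s (s' : 'I_(gres_rank F i.+1) -> 'I_(gres_rank F i.+2) -> R) :
  (forall t j, \sum_m s' t m * gres_d m j =
    r * unit_row t j - \sum_l gres_d t l * s l j) -> @presec i.+1 s'.
Proof.
move=> hs' t m; under eq_bigr do rewrite hs' mulrBr mulrCA.
rewrite sumrB -mulr_sumr.
rewrite (_ : \sum_j gres_d t j * unit_row j m = gres_d t m); last first.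
  rewrite -[RHS](@sum_unit_row _ R^o m (fun j => gres_d t j)).
  by apply: eq_bigr => j _; rewrite !ffunE eq_sym [LHS]mulrC.
rewrite (_ : \sum_j _ = 0) ?subr0 //.
under eq_bigr do rewrite mulr_sumr.
rewrite exchange_big big1 //= => l _.
under eq_bigr do rewrite mulrA.
by rewrite -mulr_suml gres_dd mul0r.
Qed.

Lemma presec_exists i : exists s, @presec i s.
Proof.
elim: i => [|i [s hs]].
  have [s hs] := htpy0; exists s => t m; under eq_bigr do rewrite hs mulrCA.
  rewrite -mulr_sumr; congr (_ * _).
  rewrite -[RHS](@sum_unit_row _ R^o m (fun j => gres_d t j)).
  by apply: eq_bigr => j _; rewrite !ffunE eq_sym [LHS]mulrC.
by have [s' hs'] := htpy_step hs; exists s'; apply: presec_step hs'.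
Qed.

Lemma cocycle_kill0 N (z : coch N 0) : cod N 0 z = 0 -> r *: z = 0.
Proof.
move=> dz; apply/ffunP => l; rewrite !ffunE; have [s hs] := htpy0.
rewrite -(sum_unit_row l z) scaler_sumr.
under eq_bigr do rewrite scalerA -hs scaler_suml.
rewrite exchange_big big1 //= => j _.
under eq_bigr do rewrite -scalerA.
by rewrite -scaler_sumr -codE dz ffunE scaler0.
Qed.

(** The null-homotopy, transposed: composing [z] with [s] gives the primitive, and the term through
    [s'] contains [cod F N i.+1 z], which is zero. Thus [r] annihilates the cohomology of Hom(F, N)
    for every [N]. *)
Lemma cocycle_killS N i (z : coch N i.+1) : cod N i.+1 z = 0 ->
  exists y, r *: z = cod N i y.
Proof.
move=> dz; have [s hs] := presec_exists i; have [s' hs'] := htpy_step hs.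
exists [ffun l => \sum_j s l j *: z j]; apply/ffunP => t; rewrite codE ffunE.
transitivity (\sum_j (r * unit_row t j - \sum_m s' t m * gres_d m j) *: z j); last first.
  under eq_bigr do rewrite hs' opprB addrC subrK scaler_suml.
  rewrite exchange_big; apply: eq_bigr => l _; rewrite ffunE scaler_sumr.
  by apply: eq_bigr => j _; rewrite scalerA.
under eq_bigr do rewrite scalerBl -scalerA scaler_suml.
rewrite sumrB -scaler_sumr sum_unit_row exchange_big /= big1 ?subr0 // => m _.
under eq_bigr do rewrite -scalerA.
by rewrite -scaler_sumr -codE dz ffunE scaler0.
Qed.

End Homotopy.
End Cochains.

Arguments cod {k n M} F N i : simpl never.

(** * Dimension shifting in the double complex Hom(F, Cousin) *)

Section Zigzag.
Variables (k : fieldType) (n : nat).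
Local Notation R := {mpoly k[n]}.
Variables (M : gmod R) (F : gresolution M) (d : nat).
Local Notation C := (coch F (cousin k n)).
Local Notation dF := (cod F (cousin k n) _).
Local Notation dE := (postcomp (@delta k n)).

Hypothesis killM : forall S : {set 'I_n}, (d < #|S|)%N ->
  forall m : M, 'X_[mnm_ind S] *: m = 0.

Definition clevel t i (z : C i) := forall l, level t (z l).

Lemma clevel_cod t i (z : C i) : clevel t z -> clevel t (dF z).
Proof. by move=> lz l; rewrite codE; apply: level_sum => m; apply: levelZ. Qed.

Lemma clevelB t i (z z' : C i) : clevel t z -> clevel t z' -> clevel t (z - z').
Proof. by move=> lz lz' l; rewrite ffunE ffunE; apply: levelB. Qed.

Lemma clevelP t i p (z z' : C i) : clevel t z -> clevel t z' -> clevel t (p *: z + z').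
Proof. by move=> lz lz' l; rewrite !ffunE; apply: levelD => //; apply: levelZ. Qed.

Lemma clevel_dE t i (z : C i) : clevel t.+1 z -> clevel t (dE z).
Proof. by move=> lz l; rewrite ffunE; apply: level_delta. Qed.

Lemma dEP i p (z z' : C i) : dE (p *: z + z') = p *: dE z + dE z'.
Proof. exact: linearP. Qed.

Lemma dEB i (z z' : C i) : dE (z - z') = dE z - dE z'.
Proof. exact: linearB. Qed.

Lemma dE0 i : dE (0 : C i) = 0.
Proof. exact: linear0. Qed.

Lemma dEK i (z : C i) : dE (dE z) = 0.
Proof. by apply/ffunP => l; rewrite !ffunE deltaK. Qed.

Lemma dE_exact t i (z : C i) : (t < n)%N -> clevel t z -> dE z = 0 ->
  exists2 y, clevel t.+1 y & dE y = z.
Proof.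
move=> tn lz dz; exists (postcomp (@htp k n) z).
  by move=> l; rewrite ffunE; apply: level_htp.
apply/ffunP => l; rewrite !ffunE; apply: delta_exact (lz l) _ => //.
by move/ffunP: dz => /(_ l); rewrite !ffunE.
Qed.

Lemma clevel_comp t i (z : C i) : clevel t z ->
  z = \sum_(T : {set 'I_n} | #|T| == t) postcomp (comp (pred1 T)) z.
Proof.
move=> lz; apply/ffunP => l; rewrite {1}(level_comp (lz l)) sum_ffunE.
by apply: eq_bigr => T _; rewrite ffunE.
Qed.

Lemma postcomp_invcK T i (z : C i) :
  postcomp (invc T) ('X_[mnm_ind T] *: z) = postcomp (comp (pred1 T)) z.
Proof. by apply/ffunP => l; rewrite !ffunE linearZ /= invcK. Qed.

Lemma acyclic0 t (z : C 0) : (d < t)%N -> clevel t z -> dF z = 0 -> z = 0.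
Proof.
move=> dt lz dz; rewrite (clevel_comp lz) big1 // => T /eqP Tt.
rewrite -postcomp_invcK (@cocycle_kill0 _ _ _ F _ _ _ _ dz) ?linear0 //.
by apply: killM; rewrite Tt.
Qed.

Lemma acyclicS t i (z : C i.+1) : (d < t)%N -> clevel t z -> dF z = 0 ->
  exists2 y, clevel t y & dF y = z.
Proof.
move=> dt lz dz.
(* [y T] is a primitive of x_T times [z]; applying [invc T] to it gives a primitive of the
   [T]-component of [z]. Sets of another size get the dummy value 0. *)
have /choice[y hy] (T : {set 'I_n}) :
    exists y, #|T| = t -> 'X_[mnm_ind T] *: z = dF y.
  have [Tt|ne] := eqVneq #|T| t; last by exists 0 => Tt; case/eqP: ne.
  have [|y ->] := @cocycle_killS _ _ _ F 'X_[mnm_ind T] _ _ _ _ dz; last by exists y.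
  by apply: killM; rewrite Tt.
exists (\sum_(T : {set 'I_n} | #|T| == t) postcomp (invc T) (y T)).
  move=> l; rewrite sum_ffunE; apply: big_ind => //; first exact: levelD.
  by move=> T /eqP <-; rewrite ffunE; apply: level_invc.
rewrite linear_sum [RHS](clevel_comp lz); apply: eq_bigr => T /eqP Tt.
by rewrite [LHS]cod_postcomp -hy // postcomp_invcK.
Qed.

(* [z] in Hom(F_i, E) and [w] in Hom(F_0, E) correspond to each other along the
   staircase of the double complex Hom(F, E). *)
Fixpoint zigzag i : C i -> C 0 -> Prop :=
  match i return C i -> C 0 -> Prop with
  | 0 => fun z w => z = w
  | i'.+1 => fun z w => exists y : C i',
      [/\ clevel (d + i'.+1) y, dF y = z & zigzag (dE y) w]
  end.

Definition closed i (z : C i) := [/\ clevel (d + i) z, dE z = 0 & dF z = 0].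

(** When d + i = n, the [u] of level n killed by [dE] are the cochains with values in R(-n), so this
    says that [z] is a coboundary there. The intermediate stages serve the inductions along the
    staircase. *)
Definition bounds i : C i -> Prop :=
  match i return C i -> Prop with
  | 0 => fun z => z = 0
  | i'.+1 => fun z => exists u : C i',
      [/\ clevel (d + i'.+1) u, dE u = 0 & dF u = z]
  end.

Lemma zigzag_linear i p (z z' : C i) w w' :
  zigzag z w -> zigzag z' w' -> zigzag (p *: z + z') (p *: w + w').
Proof.
elim: i z z' => [|i IH] z z'; first by move=> -> ->.
move=> [y [ly <- hy]] [y' [ly' <- hy']]; exists (p *: y + y'); split.
- exact: clevelP.
- by rewrite codP.
by rewrite dEP; apply: IH.
Qed.

(** Each step takes a primitive along [dF], which exists because the level is above d. *)
Lemma zigzag_down i (z : C i) : closed z -> exists2 w : C 0, closed w & zigzag z w.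
Proof.
elim: i z => [|i IH] z cz; first by exists z.
have [lz ez fz] := cz.
have [|y ly yz] := acyclicS _ lz fz; first by lia.
have [|w cw zw] := IH (dE y).
  split; first by apply: clevel_dE; rewrite -addnS.
    exact: dEK.
  by rewrite cod_postcomp yz.
by exists w => //; exists y.
Qed.

(** Each step takes a primitive along [dE], which exists because the level is below n. *)
Lemma zigzag_up i (w : C 0) : (d + i <= n)%N -> closed w ->
  exists2 z : C i, closed z & zigzag z w.
Proof.
elim: i => [|i IH] din cw; first by exists w.
have [|z [lz ez fz] zw] := IH _ cw; first by lia.
have [|y ly yz] := dE_exact _ lz ez; first by lia.
exists (dF y); last by exists y; rewrite yz addnS; split.
split; first by rewrite addnS; apply: clevel_cod.
  by rewrite -[LHS]cod_postcomp yz.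
exact: codK.
Qed.

(** The primitive [y] of the zigzag and the [u] witnessing [bounds] differ by a [dF]-cocycle of
    level above d. It is zero at the last step and otherwise equals [dF v]; then [dE v] witnesses
    [bounds] one stage lower. *)
Lemma zigzag_bounds i (z : C i) w : zigzag z w -> bounds z -> w = 0.
Proof.
elim: i z => [|i IH] z; first by move=> ->.
move=> [y [ly <- yw]] [u [lu eu fu]]; apply: IH yw _.
have lyu : clevel (d + i.+1) (y - u) by apply: clevelB.
have fyu : dF (y - u) = 0 by rewrite codB fu subrr.
have eyu : dE y = dE (y - u) by rewrite dEB eu subr0.
case: i y u {z ly lu eu fu} lyu fyu eyu => [|i] y u lyu fyu eyu.
  by rewrite eyu (acyclic0 _ lyu fyu) ?dE0 //; lia.
have [|v lv fv] := acyclicS _ lyu fyu; first by lia.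
exists (dE v); split; first by apply: clevel_dE; rewrite -addnS.
  exact: dEK.
by rewrite cod_postcomp fv eyu.
Qed.

(** The dual correction: the [u] obtained for [dE y] lifts to some [v] along [dE], and [y - dF v]
    has the same [dF] as [y] but is killed by [dE]. *)
Lemma zigzag0 i (z : C i) : (d + i <= n)%N -> zigzag z 0 -> bounds z.
Proof.
elim: i z => [|i IH] z din // [y [ly <- /IH]].
case: i y {z IH} ly din => [|i] y ly din.
  by move=> h; exists y; split=> //; apply: h; lia.
case; first by lia.
move=> u [lu eu fu]; have [|v lv ev] := dE_exact _ lu eu; first by lia.
exists (y - dF v); split.
- by apply: clevelB => //; rewrite addnS; apply: clevel_cod.
- by rewrite dEB -cod_postcomp ev fu subrr.
by rewrite codB codK subr0.
Qed.

(** The component of degree [j] of a homomorphism from F_i. It commutes with both differentials, so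
    a zigzag can be made homogeneous after its primitives have been chosen. *)
Definition hpart j i (z : C i) : C i := [ffun l => homc (gres_deg l + j) (z l)].

Lemma hpart_cod j i (z : C i) : dF (hpart j z) = hpart j (dF z).
Proof.
apply/ffunP => t; rewrite codE ffunE codE raddf_sum; apply: eq_bigr => l _.
rewrite ffunE -(@homc_pieceZ _ _ (gres_deg t - gres_deg l)); last exact: gres_d_homog.
by rewrite addrA subrK.
Qed.

Lemma hpart_dE j i (z : C i) : dE (hpart j z) = hpart j (dE z).
Proof. by apply/ffunP => t; rewrite !ffunE delta_homc. Qed.

Lemma zigzag_hpart j i (z : C i) w : zigzag z w -> zigzag (hpart j z) (hpart j w).
Proof.
elim: i z => [|i IH] z; first by move=> ->.
move=> [y [ly <- /IH yw]]; exists (hpart j y); split.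
- by move=> l; rewrite ffunE; apply: level_homc.
- exact: hpart_cod.
by rewrite hpart_dE.
Qed.

Lemma closed_hpart j i (z : C i) : closed z -> closed (hpart j z).
Proof.
case=> lz ez fz; split.
- by move=> l; rewrite ffunE; apply: level_homc.
- by rewrite hpart_dE ez; apply/ffunP => l; rewrite !ffunE raddf0.
by rewrite hpart_cod fz; apply/ffunP => l; rewrite !ffunE raddf0.
Qed.

End Zigzag.

(** * The canonical module as a module of cycles *)

Section StanleyReisnerIdeal.
Variables (k : fieldType) (n : nat) (D : scomplex n).
Local Notation R := {mpoly k[n]}.
Implicit Types (p q : R) (S : {set 'I_n}).

Lemma prod_mpolyX S : \prod_(i in S) 'X_i = 'X_[mnm_ind S] :> R.
Proof.
rewrite mpolyXE_id big_mkcond /=; apply: eq_bigr => i _.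
by rewrite mnmE; case: (i \in S); rewrite ?expr1 ?expr0.
Qed.

Lemma mnm_ind_le m S : (mnm_ind S <= m)%MM = (S \subset msup m).
Proof.
apply/mnm_lepP/subsetP => h i; first by move=> iS; move: (h i); rewrite mnmE iS inE lt0n.
by rewrite mnmE; case: (boolP (i \in S)) => // /h; rewrite inE lt0n.
Qed.

Lemma SR_idealP p : reflect (forall m, p@_m != 0 -> msup m \notin faces D)
  (p \in SR_ideal D).
Proof.
apply: (iffP idP) => [/asboolP[c ->] m|h].
  apply: contraNN => mD; rewrite raddf_sum big1 //= => S SD.
  rewrite prod_mpolyX mcoeff_mform mulrC mformM mformX.
  rewrite -[RHS](mform_fun0 (c S)); apply: eq_mform => m' _.
  case: eqP => // e; case/negP: SD; apply: (@faces_sub _ D S _ _ mD).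
  by rewrite -mnm_ind_le -e lem_addr.
(* Each monomial of [p] is charged to the generator given by its own support, which is a nonface. *)
apply/asboolP; exists (fun S =>
  \sum_(m <- msupp p | msup m == S) p@_m *: 'X_[m - mnm_ind S]).
rewrite {1}[p]mpolyE.
transitivity (\sum_(m <- msupp p) \sum_(S : {set 'I_n} | (S \notin faces D) && (msup m == S))
    p@_m *: 'X_[m - mnm_ind S] * 'X_[mnm_ind S]).
  apply: eq_big_seq => m; rewrite mcoeff_msupp => /h mD.
  rewrite (big_pred1 (msup m)) => [|S]; last first.
    by rewrite /= [in RHS]eq_sym; case: eqP => [<-|]; rewrite ?mD ?andbF.
  by rewrite -scalerAl -mpolyXD submK // mnm_ind_le.
rewrite (exchange_big_dep (fun S => S \notin faces D)) /=; last by move=> m S _ /andP[].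
apply: eq_bigr => S SD; rewrite prod_mpolyX mulr_suml SD.
by apply: eq_bigl.
Qed.

Lemma SR_piE p q : (SR_pi D p = SR_pi D q) <-> (p - q \in SR_ideal D).
Proof.
by rewrite /SR_pi -[p - q \in _]/(p - q \in Idealr.clone _ (SR_ideal D) _) Quotient.idealrBE; split=> /eqP.
Qed.

Lemma SR_pi0 p : (SR_pi D p = 0) <-> (p \in SR_ideal D).
Proof. by rewrite -[X in _ = X](raddf0 (SR_pi D)) SR_piE subr0. Qed.

Lemma SR_pi_surj (x : SR_ring k D) : exists p, x = SR_pi D p.
Proof. by exists (repr x); rewrite /SR_pi reprK. Qed.

Lemma SR_scaleE p q : p *: SR_pi D q = SR_pi D (p * q).
Proof. by rewrite rmorphM. Qed.

Lemma SR_kill S : S \notin faces D -> forall x : SR_ring k D, 'X_[mnm_ind S] *: x = 0.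
Proof.
move=> SD x; have [p ->] := SR_pi_surj x; rewrite SR_scaleE; apply/SR_pi0/SR_idealP => m.
apply: contraNN => mD; apply/eqP; rewrite mcoeff_mform mformM mformX.
rewrite -[RHS](mform_fun0 p); apply: eq_mform => m' _.
case: eqP => // e; case/negP: SD; apply: (@faces_sub _ D S _ _ mD).
by rewrite -mnm_ind_le -e lem_addr.
Qed.

Definition top_card : nat := \max_(s in faces D) #|s|.

Lemma top_card_ge S : S \in faces D -> (#|S| <= top_card)%N.
Proof. by move=> SD; apply: (@leq_bigmax_cond _ (fun S => S \in faces D)). Qed.

Lemma top_card_le_n : (top_card <= n)%N.
Proof. by apply/bigmax_leqP => S _; have := max_card (mem S); rewrite card_ord. Qed.

End StanleyReisnerIdeal.

Section HomologyClass.
Variables (R : nzRingType) (U V W : lmodType R).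
Variables (f : {linear U -> V}) (g : {linear V -> W}).

Lemma homology_class_eq (z z' : cycle g) :
  homology_class f z = homology_class f z' <-> exists u, f u = val z - val z'.
Proof.
rewrite /homology_class mquot_piE; split => [/asboolP[u hu]|[u hu]]; first by exists u.
by apply/asboolP; exists u; rewrite hu.
Qed.

Lemma homology_class0 : homology_class f (0 : cycle g) = 0.
Proof. exact: linear0. Qed.

Lemma homology_classP (h : homology f g) : exists z, h = homology_class f z.
Proof. by exists (repr h); rewrite /homology_class mquot_piK. Qed.

End HomologyClass.

(** * Ext in degree n - d as the cycles of level d killed by the Stanley-Reisner ideal *)

Section CanonicalModule.
Variables (k : fieldType) (n : nat) (D : scomplex n) (F : gresolution (SR_gmod k D)).
Local Notation R := {mpoly k[n]}.
Local Notation E := (cousin k n).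
Local Notation d := (top_card D).
Local Notation C := (coch F E).
Local Notation dF := (cod F E _).
Local Notation dE := (postcomp (@delta k n)).

Definition canon (e : E) : Prop :=
  [/\ level d e, delta e = 0 & forall p, p \in SR_ideal D -> p *: e = 0].

Lemma canon_linear p e e' : canon e -> canon e' -> canon (p *: e + e').
Proof.
move=> [le de ke] [le' de' ke']; split.
- by apply: levelD => //; apply: levelZ.
- by rewrite deltaP de de' scaler0 addr0.
by move=> q qI; rewrite scalerDr scalerA mulrC -scalerA ke // scaler0 add0r ke'.
Qed.

Lemma gres_aug_poly : exists P : 'I_(gres_rank F 0) -> R, forall l,
  mpoly_piece (gres_deg l) (P l) /\ gres_aug l = SR_pi D (P l).
Proof.
suff /choice[P hP] : forall l : 'I_(gres_rank F 0), exists p : R,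
  mpoly_piece (gres_deg l) p /\ gres_aug l = SR_pi D p by exists P.
by move=> l; have [p ? ?] := gres_aug_homog l; exists p.
Qed.

(** An [e] killed by the ideal is the homomorphism on k[D] sending 1 to [e]; this is its composite
    with the augmentation of [F]. *)
Definition expand (P : 'I_(gres_rank F 0) -> R) (e : E) : C 0 := [ffun l => P l *: e].

Section Presentation.
Variables (P : 'I_(gres_rank F 0) -> R) (x : {ffun 'I_(gres_rank F 0) -> R^o}).
Hypothesis PE : forall l, mpoly_piece (gres_deg l) (P l) /\ gres_aug l = SR_pi D (P l).
Hypothesis xE : SR_pi D 1 = \sum_l x l *: gres_aug l :> SR_ring k D.

Lemma sum_augE (y : {ffun 'I_(gres_rank F 0) -> R^o}) :
  \sum_l y l *: gres_aug l = SR_pi D (\sum_l y l * P l) :> SR_ring k D.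
Proof.
rewrite rmorph_sum; apply: eq_bigr => l _.
by rewrite (PE l).2 SR_scaleE.
Qed.

Lemma sum_xP : \sum_l x l * P l - 1 \in SR_ideal D.
Proof. by apply/SR_piE; rewrite -sum_augE -xE. Qed.

Lemma cocycle_ker (w : C 0) (y : {ffun 'I_(gres_rank F 0) -> R^o}) : dF w = 0 ->
  \sum_l y l * P l \in SR_ideal D -> \sum_l y l *: w l = 0.
Proof.
move=> fw yI; have /gres_exact0[t ->] : \sum_l y l *: gres_aug l = 0 :> SR_gmod k D.
  by rewrite sum_augE; apply/SR_pi0.
transitivity (\sum_j t j *: dF w j).
  under [RHS]eq_bigr do rewrite codE scaler_sumr.
  rewrite exchange_big; apply: eq_bigr => l _; rewrite ffunE scaler_suml.
  by apply: eq_bigr => j _; rewrite scalerA [in RHS]mulrC.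
by rewrite fw big1 // => j _; rewrite ffunE scaler0.
Qed.

(** A cocycle in degree 0 factors through k[D] and is determined by its value at 1; this value is
    the sum in [x], because [x] lifts 1 to F_0. *)
Lemma cocycle_expand (w : C 0) : dF w = 0 -> w = expand P (\sum_l x l *: w l).
Proof.
move=> fw; apply/ffunP => l; rewrite ffunE scaler_sumr.
(* The basis element [l] and [P l] times the lift of 1 have the same image in k[D], so their
   difference is a syzygy. *)
pose y := [ffun m => unit_row k n l m - P l * x m : R^o].
have := @cocycle_ker w y fw; rewrite /y.
under eq_bigr do rewrite ffunE mulrBl.
rewrite sumrB -[X in X - _]/(\sum_l0 unit_row k n l l0 *: (P l0 : R^o)) sum_unit_row.
under eq_bigr do rewrite -mulrA.
rewrite -mulr_sumr.
have -> : P l - P l * (\sum_l0 x l0 * P l0) = - P l * (\sum_l0 x l0 * P l0 - 1).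
  by rewrite mulrBr mulr1 opprK mulNr addrC.
move/(_ (idealMr _ sum_xP)); under eq_bigr do rewrite ffunE scalerBl.
rewrite sumrB sum_unit_row => /eqP; rewrite subr_eq0 => /eqP ->.
by apply: eq_bigr => m _; rewrite scalerA.
Qed.

Lemma closed_canon (w : C 0) : closed d w -> canon (\sum_l x l *: w l).
Proof.
rewrite /closed addn0 => -[lw ew fw]; split.
- by apply: level_sum => l; apply: levelZ.
- rewrite delta_sum big1 // => l _; rewrite deltaZ.
  by move/ffunP: ew => /(_ l); rewrite !ffunE => ->; rewrite scaler0.
move=> p pI; rewrite scaler_sumr.
rewrite -[RHS](@cocycle_ker w [ffun l => p * x l : R^o] fw).
  by apply: eq_bigr => l _; rewrite ffunE scalerA.
under eq_bigr do rewrite ffunE -mulrA.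
by rewrite -mulr_sumr mulrC; apply: idealMr.
Qed.

Lemma expand_closed e : canon e -> closed d (expand P e).
Proof.
rewrite /closed addn0 => -[le de ke]; split.
- by move=> l; rewrite ffunE; apply: levelZ.
- by apply/ffunP => l; rewrite !ffunE deltaZ de scaler0.
apply/ffunP => j; rewrite codE [RHS]ffunE.
under eq_bigr do rewrite ffunE scalerA.
rewrite -scaler_suml; apply: ke.
pose y : {ffun 'I_(gres_rank F 0) -> R^o} := [ffun l => gres_d j l : R^o].
have : \sum_l y l *: gres_aug l = 0 :> SR_gmod k D.
  by apply/(@gres_exact0 _ _ _ F); exists (unit_row k n j); rewrite mxact_unit_row.
rewrite sum_augE => /SR_pi0; rewrite (eq_bigr (fun l => gres_d j l * P l)) // => l _.
by rewrite ffunE.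
Qed.

Lemma expandK e : canon e -> \sum_l x l *: expand P e l = e.
Proof.
move=> [_ _ ke]; under eq_bigr do rewrite ffunE scalerA.
by rewrite -scaler_suml -[LHS]subr0 -(ke _ sum_xP) scalerBl scale1r opprB addrC subrK.
Qed.

Lemma expand0 e : canon e -> expand P e = 0 -> e = 0.
Proof.
move=> ce e0; rewrite -(expandK ce) e0 big1 // => l _.
by rewrite ffunE scaler0.
Qed.

End Presentation.

Lemma canonX0 e m (S : {set 'I_n}) (a : {ffun 'I_n -> int}) : canon e -> msup m \notin faces D -> pos a \subset S ->
  e S (a - mexp m) = 0.
Proof.
move=> [_ _ ke] mD aS; rewrite -cousinXE // ke //.
by apply/SR_idealP => m'; rewrite mcoeffX; case: (m =P m') => [<- //|_]; rewrite eqxx.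
Qed.

(** The ideal is spanned by monomials, so being killed by it is tested coefficient by coefficient
    and passes to homogeneous parts. *)
Lemma canon_homc j e : canon e -> canon (homc j e).
Proof.
move=> ce; have [le de _] := ce; split.
- exact: level_homc.
- by rewrite delta_homc de raddf0.
move=> p /SR_idealP pI; apply: cousin_eq => S a aS; rewrite cousinZE // cousin0E.
rewrite -[RHS](mform_fun0 p); apply: eq_mform => m; rewrite mcoeff_msupp => /pI mD.
by rewrite homcE (canonX0 ce) // if_same.
Qed.

Section ExtClasses.
Variable c : nat.
Hypothesis dcn : (d + c = n)%N.
Local Notation N := (mpoly_shift k n (- n%:Z)).
Local Notation zclass := (homology_class (codiff_in F N c)).
Local Notation emb := (@postcomp k n (SR_gmod k D) F R^o E (@embed k n) _).

Lemma emb_inj i : injective (emb : coch F R^o i -> C i).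
Proof.
move=> z z' /ffunP e; apply/ffunP => l; apply: embed_inj.
by move: (e l); rewrite !ffunE.
Qed.

Lemma emb_surj i (z : C i) : clevel n z -> dE z = 0 ->
  exists u : coch F R^o i, emb u = z.
Proof.
move=> lz ez; suff /choice[u hu] : forall l, exists p, embed p = z l.
  by exists [ffun l => u l]; apply/ffunP => l; rewrite !ffunE hu.
by move=> l; apply: embed_surj (lz l) _; move/ffunP: ez => /(_ l); rewrite !ffunE.
Qed.

Lemma emb0 i : emb (0 : coch F R^o i) = 0.
Proof. by apply/ffunP => l; rewrite !ffunE linear0. Qed.

Lemma cod_emb i (z : coch F R^o i) : dF (emb z) = emb (cod F R^o i z).
Proof. exact: cod_postcomp. Qed.

Lemma emb_level i (z : coch F R^o i) : clevel n (emb z).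
Proof. by move=> l; rewrite ffunE; apply: level_embed. Qed.

Lemma emb_dE i (z : coch F R^o i) : dE (emb z) = 0.
Proof. by apply/ffunP => l; rewrite !ffunE delta_embed. Qed.

Lemma cycle_val (z : cycle (codiff F N c)) : cod F R^o c (val z) = 0.
Proof. by apply/eqP; apply: (valP z). Qed.

Lemma emb_closed (z : cycle (codiff F N c)) : closed d (emb (val z) : C c).
Proof.
split; first by rewrite dcn; apply: emb_level.
  exact: emb_dE.
by rewrite cod_emb cycle_val; exact: emb0.
Qed.

Lemma closed_emb (z : C c) : closed d z ->
  exists u : cycle (codiff F N c), emb (val u) = z.
Proof.
rewrite /closed dcn => -[lz ez fz]; have [u hu] := emb_surj lz ez.
have cu : u \in in_ker (codiff F N c).
  apply/eqP; apply: (@emb_inj c.+1); rewrite -cod_emb hu fz; apply: esym.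
  exact: emb0.
by exists (exist _ u cu).
Qed.

Lemma bounds_emb (u : coch F R^o c) :
  bounds d (emb u : C c) <-> exists v, codiff_in F N c v = u.
Proof.
move: dcn u; case: c => [|i] e u; split.
- move=> u0; exists 0; apply: (@emb_inj 0); rewrite u0.
  exact: emb0.
- move=> [v <-]; rewrite (_ : codiff_in F N 0 v = 0) //; exact: emb0.
- move=> [w [lw ew fw]]; have [v hv] : exists v : coch F R^o i, emb v = w.
    by rewrite e in lw; apply: emb_surj.
  by exists v; apply: (@emb_inj i.+1); rewrite -[LHS]cod_emb hv fw.
move=> [v <-]; exists (emb v); split.
- by rewrite e; apply: emb_level.
- exact: emb_dE.
exact: cod_emb.
Qed.

Lemma SR_kill_level (S : {set 'I_n}) : (d < #|S|)%N ->
  forall m : SR_gmod k D, 'X_[mnm_ind S] *: m = 0.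
Proof. by move=> lt_d; apply: SR_kill; apply: contraL lt_d => /top_card_ge; rewrite -leqNgt. Qed.

Section Correspondence.
Variables (P : 'I_(gres_rank F 0) -> R) (x : {ffun 'I_(gres_rank F 0) -> R^o}).
Hypothesis PE : forall l, mpoly_piece (gres_deg l) (P l) /\ gres_aug l = SR_pi D (P l).
Hypothesis xE : SR_pi D 1 = \sum_l x l *: gres_aug l :> SR_ring k D.

(** The graph of the identification of Ext with the cycles. The lemmas that follow show that it is
    linear, total, surjective, single-valued, injective and compatible with degrees. *)
Definition corr (h : Ext F N c) (e : E) := canon e /\
  exists2 z, h = zclass z & zigzag d (emb (val z) : C c) (expand P e).

Lemma corr_exists h : exists e, corr h e.
Proof.
have [z ->] := homology_classP h.
have [w cw zw] := zigzag_down SR_kill_level (emb_closed z).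
exists (\sum_l x l *: w l); split; first exact: (closed_canon x PE cw).
by exists z => //; rewrite -(cocycle_expand PE xE) //; case: cw.
Qed.

Lemma corr_surj e : canon e -> exists h, corr h e.
Proof.
move=> ce; have [|z cz zw] := @zigzag_up k n _ F d c _ _ (expand_closed PE ce).
  by rewrite dcn.
have [u hu] := closed_emb cz.
by exists (zclass u); split=> //; exists u => //; rewrite hu.
Qed.

Lemma corr_linear p h h' e e' :
  corr h e -> corr h' e' -> corr (p *: h + h') (p *: e + e').
Proof.
move=> [ce [z -> zw]] [ce' [z' -> zw']]; split; first exact: canon_linear.
exists (p *: z + z').
  by rewrite /homology_class linearP.
have -> : emb (val (p *: z + z')) = p *: emb (val z) + emb (val z').
  by apply/ffunP => l; rewrite !ffunE linearP.
have -> : expand P (p *: e + e') = p *: expand P e + expand P e'.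
  by apply/ffunP => l; rewrite !ffunE scalerDr !scalerA mulrC.
exact: zigzag_linear.
Qed.

Lemma corr0l e : corr 0 e -> e = 0.
Proof.
move=> [ce [z h0 zw]]; apply: (expand0 PE xE ce).
apply: (zigzag_bounds SR_kill_level zw); apply/bounds_emb.
have /homology_class_eq[u hu] : zclass z = zclass 0 by rewrite -h0 homology_class0.
by exists u; rewrite hu subr0.
Qed.

Lemma corr0r h : corr h 0 -> h = 0.
Proof.
move=> [_ [z -> zw]].
have : zigzag d (emb (val z) : C c) 0.
  by rewrite (_ : 0 = expand P 0) //; apply/ffunP => l; rewrite !ffunE scaler0.
move=> /zigzag0; rewrite dcn => /(_ (leqnn _)) /bounds_emb[u hu].
have -> : zclass z = zclass 0 by apply/homology_class_eq; exists u; rewrite hu subr0.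
by rewrite homology_class0.
Qed.

Lemma corr_fun h e e' : corr h e -> corr h e' -> e = e'.
Proof.
move=> he he'; have := corr_linear (-1) he' he.
by rewrite !scaleN1r addNr => /corr0l /eqP; rewrite addrC subr_eq0 => /eqP.
Qed.

Lemma corr_inj h h' e : corr h e -> corr h' e -> h = h'.
Proof.
move=> he he'; have := corr_linear (-1) he' he.
by rewrite !scaleN1r addNr => /corr0r /eqP; rewrite addrC subr_eq0 => /eqP.
Qed.

Lemma hpart_expand j e : hpart j (expand P e) = expand P (homc j e).
Proof. by apply/ffunP => l; rewrite !ffunE (homc_pieceZ _ _ (PE l).1). Qed.

Lemma corr_graded j h e : corr h e -> gpiece j h <-> graded j e.
Proof.
move=> he; split.
  move=> [z hz hh].
  have [w cw zw] := zigzag_down SR_kill_level (emb_closed z).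
  have ce' := closed_canon x PE cw; set e' := \sum_l _ in ce'.
  have we : w = expand P e' by apply: (cocycle_expand PE xE); case: cw.
  have he' : corr h e' by split=> //; exists z => //; rewrite -we.
  (* The degree [j] part of the zigzag starts at the same cochain, since [z] is homogeneous, and
     ends at the degree [j] part of [e']; uniqueness of the partner of [h] makes the two ends
     equal. *)
  rewrite (corr_fun he he'); apply: corr_fun he'; split; first exact: canon_homc.
  exists z => //; rewrite -hpart_expand -we.
  suff <- : hpart j (emb (val z)) = emb (val z) by apply: zigzag_hpart.
  by apply/ffunP => l; rewrite !ffunE; apply/graded_embed; apply: hz.
move=> ge; have [ce [z hz zw]] := he.
have [u hu] := closed_emb (closed_hpart j (emb_closed z)).
have hu' : corr (zclass u) e.
  split=> //; exists u => //; rewrite hu -[X in expand P X]ge -hpart_expand.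
  exact: zigzag_hpart.
exists u; last exact: corr_inj he hu'.
move=> l; apply/graded_embed; move/ffunP: hu => /(_ l); rewrite !ffunE => ->.
exact: homcK.
Qed.

End Correspondence.

(** All that the rest of the argument knows about Ext and about [F]. *)
Lemma ext_canon : exists phi : {linear Ext F N c -> E}, [/\ injective phi,
  forall e, canon e <-> exists h, phi h = e &
  forall j h, gpiece j h <-> graded j (phi h)].
Proof.
have [P PE] := gres_aug_poly.
have [x xE] := @gres_surj _ _ _ F (SR_pi D 1).
have /choice[phi hphi] := corr_exists PE xE.
have lin : linear phi.
  move=> p h h'; apply: (corr_fun PE xE (hphi _)).
  exact: corr_linear.
pose f : {linear Ext F N c -> E} := HB.pack phi (GRing.isLinear.Build _ _ _ _ phi lin).
exists f; split=> [h h' e|e|j h].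
- by apply: (corr_inj (hphi h)); rewrite [phi h]e.
- split=> [/(corr_surj PE)[h he]|[h <-]]; last by case: (hphi h).
  by exists h; apply: (corr_fun PE xE (hphi h) he).
exact: (corr_graded PE xE).
Qed.

End ExtClasses.
End CanonicalModule.

(** * Relative cycles and pseudomanifolds *)

Section RelativeCycles.
Variables (k : fieldType) (n : nat) (D : scomplex n).
Local Notation d := (top_card D).
Local Notation sgn := (sgn k).
Implicit Types (F G H S T : {set 'I_n}) (w : {set 'I_n} -> k).

(* Top-dimensional chains on the facets containing [F] whose boundary vanishes
   at every ridge containing [F], i.e. top-dimensional cycles of the link. *)
Definition relcycle F w : Prop :=
  (forall S, w S != 0 -> [/\ S \in faces D, #|S| = d & F \subset S]) /\
  (forall H, F \subset H -> \sum_(v | v \notin H) sgn v H * w (v |: H) = 0).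

Lemma relcycle_linear F c w w' : relcycle F w -> relcycle F w' ->
  relcycle F (fun S => c * w S + w' S).
Proof.
move=> [h1 h2] [h1' h2']; split=> [S|H FH].
  have [->|/h1 //] := eqVneq (w S) 0; rewrite mulr0 add0r; exact: h1'.
under eq_bigr do rewrite mulrDr mulrCA.
by rewrite big_split -mulr_sumr /= h2 // h2' // mulr0 addr0.
Qed.

Definition restr F w S : k := if F \subset S then w S else 0.

Lemma relcycle_restr F G w : F \subset G -> relcycle F w -> relcycle G (restr G w).
Proof.
move=> FG [h1 h2]; split=> [S|H GH].
  by rewrite /restr; case: ifP => [GS /h1[]|]; rewrite ?eqxx.
rewrite -[RHS](h2 H) ?(subset_trans FG) //; apply: eq_bigr => v vH.
by rewrite /restr (subset_trans GH) ?subsetUr.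
Qed.

(** The second clause keeps the annihilator of the element given by [w0] within the Stanley-Reisner
    ideal; the third makes that element generate the canonical module. *)
Definition generates w0 : Prop :=
  [/\ relcycle set0 w0,
      forall F, F \in faces D -> exists2 S : {set 'I_n}, F \subset S & w0 S != 0
    & forall F w, F \in faces D -> relcycle F w ->
        exists c, forall S, F \subset S -> w S = c * w0 S].

Lemma cdimE : cdim D = d%:Z - 1. Proof. by []. Qed.

Lemma fdim_top S : (fdim S = cdim D) <-> (#|S| = d).
Proof. by rewrite /fdim cdimE; split; lia. Qed.

Lemma fdim_topb S : (fdim S == cdim D) = (#|S| == d).
Proof. by apply/eqP/eqP => /fdim_top. Qed.

Lemma link_vertex F v : ([set v] \in link D F) = (v \notin F) && (v |: F \in faces D).
Proof.
rewrite inE faces_vertex /= andbC; congr (_ && _).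
apply/eqP/idP => [/setP/(_ v)|vF]; first by rewrite !inE eqxx /= => ->.
by apply/setP => x; rewrite !inE; case: (x =P v) => //= ->; apply/negbTE.
Qed.

Lemma link_edge F S x y : S \in faces D -> F \subset S -> x \in S -> y \in S ->
  x \notin F -> y \notin F -> [set x; y] \in link D F.
Proof.
move=> SD FS xS yS xF yF; have xyS : [set x; y] \subset S by rewrite subUset !sub1set xS.
have xyFS : [set x; y] :|: F \subset S by rewrite subUset xyS.
rewrite inE (faces_sub xyS SD) (faces_sub xyFS SD) /=; apply/eqP/setP => z.
rewrite !inE; apply/negbTE/negP => /andP[/orP[]/eqP-> zF].
  by rewrite zF in xF.
by rewrite zF in yF.
Qed.

Section Pseudomanifold.
Hypothesis pm : normal_pseudomanifold D.

Lemma pm_pure F : F \in faces D -> exists S, [/\ S \in faces D, #|S| = d & F \subset S].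
Proof.
have [pureD _ _] := pm => FD.
have [S /maxsetP[SD maxS] FS] := maxset_exists (P := fun S => S \in faces D) FD.
exists S; split=> //; apply/fdim_top/pureD; split=> // T TD ST.
by rewrite (maxS T).
Qed.

Lemma pm_ridge H S S' S'' : #|H|.+1 = d -> H \in faces D -> S != S' -> S'' != S' ->
  H \subset S -> H \subset S' -> H \subset S'' ->
  S \in faces D -> S' \in faces D -> S'' \in faces D ->
  #|S| = d -> #|S'| = d -> #|S''| = d -> S'' = S.
Proof.
move=> Hd HD neq neq'' HS HS' HS'' SD SD' SD'' cS cS' cS''.
have [_ _ /(_ H HD)] := pm; rewrite /fdim cdimE => two.
have {two} /eqP/cards2P[A [B [AB e]]] : #|[set t in faces D | (fdim t == cdim D) && (H \subset t)]| = 2.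
  by apply: two; rewrite -Hd; clear; lia.
have memP T : T \in faces D -> #|T| = d -> H \subset T -> (T == A) || (T == B).
  move=> TD cT HT; have : T \in [set A; B] by rewrite -e inE TD fdim_topb cT eqxx.
  by rewrite !inE.
move: (memP _ SD cS HS) (memP _ SD' cS' HS') (memP _ SD'' cS'' HS'') neq neq''.
by move=> /orP[]/eqP-> /orP[]/eqP-> /orP[]/eqP->; rewrite ?eqxx.
Qed.

(** Induction on the codimension of [F]. In codimension 0 only [F] itself is involved; in
    codimension 1 the boundary at [F] has at most two terms, so one cannot vanish alone; from
    codimension 2 on, the link is connected and [w] is restricted to larger faces. *)
Lemma relcycle_vanish F w S : F \in faces D -> relcycle F w ->
  S \in faces D -> #|S| = d -> F \subset S -> w S = 0 -> forall T, w T = 0.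
Proof.
move Ee : (d - #|F|)%N => e; elim: e F w S Ee => [|e IH] F w S Ee FD wF SD cS FS wS T.
  apply/eqP/negPn/negP => /[dup] wT /(wF.1)[TD cT FT].
  have FeT G : #|G| = d -> F \subset G -> F = G.
    by move=> cG FG; apply/eqP; rewrite eqEcard FG cG; move: Ee; lia.
  by move: wT; rewrite -(FeT T) // (FeT S) // wS eqxx.
apply/eqP/negPn/negP => /[dup] wT /(wF.1)[TD cT FT].
have TS : T != S by apply: contraNneq wT => ->; rewrite wS.
case: e IH Ee => [|e] IH Ee.
  have [v vF Tv] : exists2 v, v \notin F & T = v |: F.
    have : #|T :\: F| == 1%N by rewrite cardsD (setIidPr FT) cT; move: Ee; clear; lia.
    move/cards1P=> [v Tv]; exists v; last by rewrite -[LHS](setID T F) (setIidPr FT) Tv setUC.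
    by have := set11 v; rewrite -Tv inE => /andP[].
  have := wF.2 F (subxx F); rewrite (bigD1 v) //= -Tv big1 => [|u /andP[uF uv]].
    by rewrite addr0 => /eqP; rewrite mulf_eq0 signr_eq0 (negbTE wT).
  have [->|/[dup] wu /(wF.1)[uD cu Fu]] := eqVneq (w (u |: F)) 0; first by rewrite mulr0.
  have uT : u |: F != T.
    apply: contra_neq uv => uT; have := setU11 u F; rewrite uT Tv !inE (negbTE uF) orbF.
    by move/eqP.
  have Fd : #|F|.+1 = d by move: Ee; clear; lia.
  have ST : S != T by rewrite eq_sym.
  by rewrite (pm_ridge Fd FD ST uT FS FT Fu SD TD uD cS cT cu) wS mulr0.
have [_ conn _] := pm.
have link_conn : connected (link D F) by apply: conn => //; rewrite /fdim cdimE; move: Ee; clear; lia.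
have pick_out G : #|G| = d -> exists2 v, v \in G & v \notin F.
  by move=> cG; apply/subsetPn/negP => /subset_leq_card; move: Ee cG; clear; lia.
have [v vS vF] := pick_out S cS; have [v' vT vF'] := pick_out T cT.
(* Vanishing at one facet through [u] spreads to all of them by induction, applied to [u |: F]. It
   passes to a neighbour of [u] in the link because purity puts the edge and [F] in a common
   facet. *)
pose Z u := forall G, u \in G -> w G = 0.
have sub_face u G : u \in G -> F \subset G -> u |: F \subset G.
  by move=> uG FG; rewrite subUset sub1set uG.
have step u G : u \in G -> u \notin F -> F \subset G -> G \in faces D -> #|G| = d ->
    w G = 0 -> Z u.
  move=> uG uF FG GD cG wG G' uG'; apply/eqP/negPn/negP => /[dup] wG' /(wF.1)[GD' _ FG'].
  have uFG' := sub_face _ _ uG' FG'; have uFG := sub_face _ _ uG FG.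
  have := IH (u |: F) (restr (u |: F) w) G _ _ _ GD cG uFG _ G'.
  rewrite /restr uFG uFG' wG => h; move: wG'; rewrite h ?eqxx //.
  - by rewrite cardsU1 uF; move: Ee; clear; lia.
  - exact: faces_sub GD.
  exact: (relcycle_restr (subsetUr _ _) wF).
have lv : [set v] \in link D F by rewrite link_vertex vF (faces_sub (sub_face _ _ vS FS)).
have lv' : [set v'] \in link D F by rewrite link_vertex vF' (faces_sub (sub_face _ _ vT FT)).
have Zv : Z v by apply: step FS SD cS wS.
have /connectP[p pth vp] := link_conn _ _ lv lv'.
suff : Z v' by move/(_ T vT)/eqP; rewrite (negbTE wT).
rewrite {}vp; elim: p v Zv pth {vS vF lv} => //= u p IHp v Zv /andP[vu pth].
apply: IHp pth; move: vu; rewrite inE => /and3P[_ vuF /eqP disj].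
have [G [GD cG sub]] := pm_pure vuF.
move: sub; rewrite !subUset !sub1set => /andP[/andP[vG uG] FG].
apply: step uG _ FG GD cG (Zv G vG).
by apply/negP => uF; have := in_set0 u; rewrite -disj !inE eqxx orbT uF.
Qed.

Lemma pm_generates w0 S0 : relcycle set0 w0 -> w0 S0 != 0 -> generates w0.
Proof.
move=> c0 w0S0.
have nz S : S \in faces D -> #|S| = d -> w0 S != 0.
  move=> SD cS; apply: contra_neq w0S0 => wS.
  exact: (relcycle_vanish (faces0 D) c0 SD cS (sub0set _) wS).
split=> // [F FD|F w FD wF].
  by have [S [SD cS FS]] := pm_pure FD; exists S => //; apply: nz.
have [S [SD cS FS]] := pm_pure FD.
(* With this constant, [w] minus the multiple of [w0] is a relative cycle vanishing at [S], hence
   everywhere. *)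
exists (w S / w0 S) => T FT; apply/esym/eqP; rewrite -subr_eq0 -opprB oppr_eq0.
have := relcycle_linear (- (w S / w0 S)) (relcycle_restr (sub0set F) c0) wF.
move=> /(relcycle_vanish FD) /(_ SD cS FS).
rewrite /restr FS mulNr divfK ?nz // addNr => /(_ erefl T).
by rewrite FT mulNr addrC => ->.
Qed.

End Pseudomanifold.

Lemma generates_pm w0 : generates w0 -> normal_pseudomanifold D /\ exists S, w0 S != 0.
Proof.
move=> [c0 ex0 gen]; split; last by have [S _] := ex0 _ (faces0 D); exists S.
have nz S : S \in faces D -> #|S| = d -> w0 S != 0.
  move=> SD cS; have [T ST wT] := ex0 S SD; have [_ cT _] := c0.1 T wT.
  suff -> : S = T by [].
  by apply/eqP; rewrite eqEcard ST cS cT leqnn.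
split.
- move=> S [SD maxS]; have [T ST wT] := ex0 S SD; have [TD cT _] := c0.1 T wT.
  by apply/fdim_top; rewrite (maxS T).
- move=> F FD dF u v; rewrite !link_vertex => /andP[uF uD] /andP[vF vD].
  set e : rel 'I_n := fun x y => [set x; y] \in link D F.
  apply/negPn/negP => nuv.
  (* If the link were disconnected, [w0] cut down to the facets meeting the component of [u] would
     still be a relative cycle around [F]; it vanishes on a facet through [v] but not on one through
     [u], so it is no multiple of [w0]. *)
  pose A S := [exists x, [&& x \in S, x \notin F & connect e u x]].
  pose w S := if A S then restr F w0 S else 0.
  have wF : relcycle F w.
    have [h1 h2] := relcycle_restr (sub0set F) c0; split=> [S|H FH].
      by rewrite /w; case: ifP => [_ /h1|]; rewrite ?eqxx.
    have [cH|cH] := eqVneq #|H|.+1 d; last first.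
      rewrite big1 // => x xH; rewrite /w; case: ifP => _; last by rewrite mulr0.
      have [->|/h1[_ + _]] := eqVneq (restr F w0 (x |: H)) 0; first by rewrite mulr0.
      by rewrite cardsU1 xH => e0; rewrite -e0 eqxx in cH.
    (* The ridge [H] has d - 1 elements and [F] at most d - 2. All facets through [H] share the
       vertex [x], so [A] agrees on them and the boundary at [H] is kept or dropped as a whole. *)
    have [x xH xF] : exists2 x, x \in H & x \notin F.
      by apply/subsetPn/negP => /subset_leq_card; move: dF; rewrite /fdim cdimE; move: cH; clear; lia.
    transitivity (\sum_(y | y \notin H)
       (if connect e u x then sgn y H * restr F w0 (y |: H) else 0)); last first.
      by case: (connect e u x); [apply: h2 | rewrite big1].
    apply: eq_bigr => y yH; have [e0|/h1[SD _ FS]] := eqVneq (restr F w0 (y |: H)) 0.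
      by rewrite /w e0 !mulr0 !if_same mulr0.
    have xS : x \in y |: H by rewrite inE xH orbT.
    rewrite /w (_ : A _ = connect e u x); first by case: ifP => _; rewrite ?mulr0.
    apply/existsP/idP => [[z /and3P[zS zF uz]]|ux]; last by exists x; apply/and3P.
    apply: connect_trans uz (connect1 _).
    exact: (link_edge SD FS).
  have [c hc] := gen F w FD wF.
  have [S uFS wS] := ex0 _ uD; have [T vFT wT] := ex0 _ vD.
  have [TD _ _] := c0.1 T wT.
  move: uFS vFT; rewrite !subUset !sub1set => /andP[uS FS] /andP[vT FT].
  have AS : A S by apply/existsP; exists u; rewrite uS uF connect0.
  have AT : A T = false.
    apply/negbTE/existsP => -[y /and3P[yT yF uy]]; case/negP: nuv.
    apply: connect_trans uy (connect1 _); exact: (link_edge TD FT).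
  have := hc S FS; rewrite /w AS /restr FS => /eqP.
  have /eqP := hc T FT; rewrite /w AT eq_sym mulf_eq0 (negbTE wT) orbF => /eqP ->.
  by rewrite mul0r (negbTE wS).
move=> H HD dH.
have cH : #|H|.+1 = d by move: dH; rewrite /fdim cdimE; clear; lia.
have split_top S : H \subset S -> #|S| = d -> exists2 v, v \notin H & S = v |: H.
  move=> HS cS; have : #|S :\: H| == 1%N by rewrite cardsD (setIidPr HS) cS -cH; clear; lia.
  move/cards1P=> [v Sv]; exists v; last by rewrite -[LHS](setID S H) (setIidPr HS) Sv setUC.
  by have := set11 v; rewrite -Sv inE => /andP[].
have addv_inj u v : u \notin H -> u |: H = v |: H -> u = v.
  by move=> uH /setP/(_ u); rewrite !inE eqxx /= (negbTE uH) orbF => /esym/eqP.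
have [S0 HS0 wS0] := ex0 H HD; have [SD0 cS0 _] := c0.1 S0 wS0.
have [v0 vH0 Sv0] := split_top S0 HS0 cS0.
(* The boundary of [w0] at [H] cannot consist of a single nonzero term, which yields a second facet
   [v1 |: H]. *)
have := c0.2 H (sub0set _); rewrite (bigD1 v0) //= -Sv0.
have [v1 /and3P[vH1 v10 w1]|none] :=
  pickP (fun v => [&& v \notin H, v != v0 & w0 (v |: H) != 0]); last first.
  rewrite big1 ?addr0 => [/eqP|v /andP[vH vv0]].
    by rewrite mulf_eq0 signr_eq0 (negbTE wS0).
  by have := none v; rewrite vH vv0 /= => /negbFE/eqP ->; rewrite mulr0.
move=> _; have [SD1 cS1 _] := c0.1 _ w1.
apply/eqP/cards2P; exists S0, (v1 |: H); split.
  by apply: contra_neq v10; rewrite Sv0 => /addv_inj ->.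
apply/setP => S2; rewrite !inE fdim_topb; apply/idP/idP; last first.
  by case/orP=> /eqP ->; apply/and3P; split=> //; rewrite ?cS0 ?cS1 ?subsetUr.
move=> /and3P[SD2 /eqP cS2 HS2]; apply/negPn; rewrite negb_or; apply/negP => /andP[S20 S21].
(* A relative cycle around [H] carried by two facets, with signs chosen to cancel at [H]. It is a
   multiple of [w0] and vanishes on the third facet [S2], where [w0] does not, so the factor would
   be zero. *)
pose w S := if S == S0 then sgn v0 H else if S == v1 |: H then - sgn v1 H else 0.
have wH : relcycle H w.
  split=> [S|H' HH'].
    rewrite /w; case: (S =P S0) => [-> _|_]; first by [].
    by case: (S =P v1 |: H) => [-> _|_]; rewrite ?eqxx //; split=> //; rewrite subsetUr.
  have [eH|neH] := eqVneq H' H; last first.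
    rewrite big1 // => v vH'.
    have card_ne S : #|S| = d -> v |: H' != S.
      move=> cS; apply: contra_neqN neH => /eqP vS; apply/esym/eqP.
      rewrite eqEcard HH'; move: cS; rewrite -vS cardsU1 vH' -cH; clear; lia.
    by rewrite /w !(negbTE (card_ne _ _)) // mulr0.
  rewrite eH (bigD1 v0) // (bigD1 v1) /=; last by rewrite vH1.
  have v01 : v1 |: H != S0 by apply: contra_neq v10; rewrite Sv0 => /addv_inj ->.
  rewrite big1 => [|v /andP[/andP[vH vv0] vv1]].
    rewrite /w -Sv0 eqxx (negbTE v01) eqxx mulrN !sgnK addr0 subrr //.
  have -> : w (v |: H) = 0; last by rewrite mulr0.
  rewrite /w ifN ?ifN //; first by apply: contra_neq vv1 => /addv_inj ->.
  by apply: contra_neq vv0; rewrite Sv0 => /addv_inj ->.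
have [c hc] := gen H w HD wH.
have := hc S2 HS2; rewrite /w (negbTE S20) (negbTE S21) => /esym/eqP.
rewrite mulf_eq0 (negbTE (nz _ SD2 cS2)) orbF => /eqP c00.
by have := hc S0 HS0; rewrite /w eqxx c00 mul0r => /eqP; rewrite signr_eq0.
Qed.

End RelativeCycles.

(** * Generators of the canonical module *)

Section CanonCycles.
Variables (k : fieldType) (n : nat) (D : scomplex n).
Local Notation R := {mpoly k[n]}.
Local Notation E := (cousin k n).
Local Notation d := (top_card D).
Implicit Types (F S T : {set 'I_n}) (a : {ffun 'I_n -> int}) (e : E).

(** If [S] were a nonface, x_S would kill [e] and yet act bijectively on the summand of [S]. *)
Lemma canon_facet e S a : canon D e -> e S a != 0 -> S \in faces D /\ #|S| = d.
Proof.
move=> ce eSa; have [le _ _] := ce; split.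
  have aS : pos a \subset S by apply: contraNT eSa => /(cousin_supp e) ->.
  apply/negPn/negP => SD; case/negP: eSa; apply/eqP.
  rewrite -(canonX0 (m := mnm_ind S) (S := S) (a := a + ind S) ce) ?msup_ind //.
    by rewrite mexp_ind addrK.
  by rewrite pos_add_ind.
by apply/eqP; apply: contraNT eSa => /le ->.
Qed.

Lemma canon_ge0_out e S a i : canon D e -> e S a != 0 -> i \notin S -> 0 <= a i.
Proof.
move=> ce eSa iS; have [SD cS] := canon_facet ce eSa.
have aS : pos a \subset S by apply: contraNT eSa => /(cousin_supp e) ->.
rewrite leNgt; apply/negP => ai; case/negP: eSa; apply/eqP.
(* [i |: S] has d + 1 elements, so it is a nonface. As [a i < 0], the exponent at [i] is still at
   most 0 after adding 1, so the raised exponent remains admissible for [S]. *)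
rewrite -(canonX0 (m := mnm_ind (i |: S)) (S := S) (a := a + ind (i |: S)) ce).
- by rewrite mexp_ind addrK.
- by rewrite msup_ind; apply/negP => /top_card_ge; rewrite cardsU1 iS cS ltnn.
apply/subsetP => j; rewrite !inE !ffunE !inE; case: (j =P i) => [->|_] /=.
  by move: (a i) ai => x; lia.
have [//|jS] := boolP (j \in S); rewrite addr0 => aj.
by move: jS; rewrite (subsetP aS) // inE.
Qed.

Lemma canon_mexp e S a : canon D e -> e S a != 0 ->
  exists2 m, a = mexp m & msup m \subset S.
Proof.
move=> ce eSa; have aS : pos a \subset S by apply: contraNT eSa => /(cousin_supp e) ->.
suff a_ge0 i : 0 <= a i.
  exists [multinom absz (a i) | i < n]; last first.
    apply: subset_trans aS; apply/subsetP => i; rewrite !inE mnmE.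
    by move: (a i) (a_ge0 i) => x; lia.
  by apply/ffunP => i; rewrite ffunE mnmE gez0_abs.
have [iS|iS] := boolP (i \in S); last exact: canon_ge0_out ce eSa iS.
rewrite leNgt; apply/negP => ai; case/negP: eSa; apply/eqP.
(* In the differential at [S :\ i] every other term belongs to a set avoiding [i], where a negative
   exponent at [i] is already excluded; the term [e S a] is left alone. *)
have aSi : pos a \subset S :\ i.
  by rewrite subsetD1 aS inE -leNgt ltW.
have [_ /(congr1 (fun f : E => f (S :\ i) a)) + _] := ce.
rewrite deltaE // (bigD1 i) ?setD11 //= setD1K // big1 => [|v /andP[vS vi]].
  by rewrite addr0 => /eqP; rewrite mulf_eq0 signr_eq0 => /eqP.
have [->|h] := eqVneq (e (v |: S :\ i) a) 0; first by rewrite mulr0.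
have /(canon_ge0_out ce h) : i \notin v |: S :\ i by rewrite !inE eqxx orbF eq_sym.
by rewrite leNgt ai.
Qed.

Lemma canon_relcycle e m : canon D e -> relcycle D (msup m) (fun S => e S (mexp m)).
Proof.
move=> ce; split=> [S eS|H mH].
  have [SD cS] := canon_facet ce eS; split=> //.
  by have [m' /mexp_inj -> ] := canon_mexp ce eS.
have [_ /(congr1 (fun f : E => f H (mexp m))) + _] := ce.
by rewrite deltaE ?pos_mexp.
Qed.

Lemma pos_ind F : pos (ind F) = F.
Proof. by rewrite -mexp_ind pos_mexp msup_ind. Qed.

Section CycleElement.
Variables (F : {set 'I_n}) (w : {set 'I_n} -> k).
Hypothesis wF : relcycle D F w.

Lemma cycle_elt_axiom : cousin_axiom (fun S a => if a == ind F then w S else 0).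
Proof.
split=> [S a|].
  case: eqP => // ->; rewrite pos_ind; apply: contraNeq => /(wF.1)[_ _ ->] //.
exists (tdeg (ind F)) => S a; case: eqP => // ->; by rewrite ltxx.
Qed.
Definition cycle_elt : E := Cousin cycle_elt_axiom.

Lemma cycle_eltE S a : cycle_elt S a = if a == ind F then w S else 0.
Proof. by []. Qed.

(** A converse of [canon_relcycle]: every relative cycle around [F] occurs in the canonical module,
    in the multidegree [ind F]. *)
Lemma canon_cycle_elt : canon D cycle_elt.
Proof.
split.
- move=> S a cS; rewrite cycle_eltE; case: eqP => // _.
  by apply: contraNeq cS => /(wF.1)[_ -> _].
- apply: cousin_eq => T a aT; rewrite deltaE // cousin0E.
  under eq_bigr do rewrite cycle_eltE.
  case: eqP aT => [->|_ _]; first by rewrite pos_ind; apply: wF.2.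
  by rewrite big1 // => v _; rewrite mulr0.
move=> p /SR_idealP pI; apply: cousin_eq => S a aS; rewrite cousinZE // cousin0E.
rewrite -[RHS](mform_fun0 p); apply: eq_mform => m; rewrite mcoeff_msupp => /pI mD.
rewrite cycle_eltE; case: eqP => // am; apply: contraNeq mD => /(wF.1)[SD _ _].
apply: faces_sub SD; apply: subset_trans aS; rewrite -pos_mexp.
apply/subsetP => i; rewrite !inE; move/ffunP: am => /(_ i); rewrite !ffunE.
by case: (i \in F); move: (a i) => x; lia.
Qed.

End CycleElement.

Lemma mform_delta (m0 : 'X_{1..n}) (u : 'X_{1..n} -> k) (p : R) :
  (forall m, m != m0 -> u m = 0) -> mform u p = p@_m0 * u m0.
Proof.
move=> u0; rewrite mcoeff_mform mulrC -mform_funZ; apply: eq_mform => m _.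
by case: eqP => [->|/eqP/u0 ->]; rewrite ?mulr1 ?mulr0.
Qed.

Lemma graded0_mexp e S a : canon D e -> graded 0 e -> a != 0 -> e S a = 0.
Proof.
move=> ce /gradedP ge; apply: contraNeq => eSa.
have [m am _] := canon_mexp ce eSa; have := ge _ _ eSa.
rewrite am tdeg_mexp => -[/eqP]; rewrite mdeg_eq0 => /eqP ->.
by rewrite mexp0.
Qed.

Lemma scale_graded0 e p S (m : 'X_{1..n}) : canon D e -> graded 0 e ->
  msup m \subset S -> (p *: e) S (mexp m) = p@_m * e S 0.
Proof.
move=> ce ge mS; rewrite cousinZE ?pos_mexp // (mform_delta (m0 := m)) ?subrr //.
move=> m' mm'; apply: graded0_mexp => //; rewrite subr_eq0.
by apply: contra_neq mm' => /mexp_inj.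
Qed.

Lemma canon_eq e e' : canon D e -> canon D e' ->
  (forall S (m : 'X_{1..n}), msup m \subset S -> e S (mexp m) = e' S (mexp m)) ->
  e = e'.
Proof.
move=> ce ce' ee'; apply: cousin_eq => S a _.
have [[m -> /ee' //]|nex] := pselect (exists2 m, a = mexp m & msup m \subset S).
have zero e1 : canon D e1 -> e1 S a = 0.
  by move=> ce1; apply/eqP/negPn/negP => /(canon_mexp ce1).
by rewrite !zero.
Qed.

Lemma canonZ p e : canon D e -> canon D (p *: e).
Proof.
move=> ce; rewrite -[_ *: _]addr0; apply: canon_linear ce _.
by split=> //; [exact: raddf0 | move=> q _; rewrite scaler0].
Qed.

(** [p] is determined only up to the annihilator of [e], so it may be inhomogeneous; its homogeneous
    part of degree [j] has the same product with [e]. *)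
Lemma canon_piece j e p : canon D e -> graded 0 e -> graded j (p *: e) ->
  exists2 p', mpoly_piece j p' & p *: e = p' *: e.
Proof.
move=> ce ge gpe; have coef (m : 'X_{1..n}) S : msup m \subset S -> (mdeg m)%:Z != j ->
    p@_m * e S 0 = 0.
  move=> mS mj; rewrite -scale_graded0 // -gpe homcE.
  by rewrite tdeg_mexp (negbTE mj).
case: j gpe coef => [dd|dd] gpe coef.
  exists (pihomog mdeg dd p); first exact: pihomogP.
  apply: canon_eq => [||S m mS]; [exact: canonZ..|].
  rewrite !scale_graded0 // pihomogE raddf_sum big_mkcond /=.
  have [md|md] := eqVneq (mdeg m) dd; last first.
    rewrite coef ?big1 ?mul0r // => m' _; case: eqP => // m'd.
    rewrite mcoeffZ mcoeffX; case: eqP => [m'm|_]; last by rewrite mulr0.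
    by rewrite -m'm m'd eqxx in md.
  rewrite [in LHS]mcoeff_mform; congr (_ * _); apply: eq_bigr => m' _.
  rewrite mcoeffZ mcoeffX; case: eqP => [->|_]; first by rewrite md eqxx.
  by rewrite mulr0 if_same.
exists 0 => //; rewrite scale0r; apply: canon_eq; first exact: canonZ.
  by have := canonZ 0 ce; rewrite scale0r.
by move=> S m mS; rewrite scale_graded0 // coef.
Qed.

(** The image of 1 under a graded isomorphism from k[D]: the third clause is injectivity, the last
    one surjectivity. *)
Definition generator (e0 : E) :=
  [/\ canon D e0, graded 0 e0, forall p : R, p *: e0 = 0 -> p \in SR_ideal D &
      forall e, canon D e -> exists p : R, e = p *: e0].

Lemma generator_generates e0 : generator e0 -> generates D (fun S => e0 S 0).
Proof.
move=> [c0 g0 inj0 gen0]; split.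
- have := canon_relcycle 0%MM c0; rewrite mexp0; congr relcycle.
  by apply/setP => i; rewrite !inE mnm0E.
- move=> F FD; apply/(@exists2P _ (fun S => F \subset S)); apply: contrapT => none.
  (* If [e0] vanished on all sets containing [F], then x_F would kill it and lie in the ideal,
     although [F] is a face. *)
  have /inj0/SR_idealP/(_ (mnm_ind F)) : ('X_[mnm_ind F] : R) *: e0 = 0.
    apply: cousin_eq => S a aS; rewrite cousinXE // cousin0E mexp_ind.
    have [aF|aF] := eqVneq (a - ind F) 0; last exact: graded0_mexp.
    rewrite aF; apply/eqP/negPn/negP => wS; case: none; exists S; split=> //.
    by move/eqP: aF aS; rewrite subr_eq0 => /eqP ->; rewrite pos_ind.
  by rewrite mcoeffX eqxx oner_eq0 msup_ind FD => /(_ isT).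
move=> F w FD wF; have [p ep] := gen0 _ (canon_cycle_elt wF).
exists p@_(mnm_ind F) => S FS.
have /(congr1 (fun f : E => f S (ind F))) := ep.
by rewrite cycle_eltE eqxx -mexp_ind scale_graded0 // msup_ind.
Qed.

Lemma generates_generator (w0 : {set 'I_n} -> k) : generates D w0 -> exists e0 : E, generator e0.
Proof.
move=> [c0 ex0 gen0]; exists (cycle_elt c0).
have ind0 : ind (set0 : {set 'I_n}) = 0 by apply/ffunP => i; rewrite !ffunE inE.
have ce := canon_cycle_elt c0.
have ge : graded 0 (cycle_elt c0).
  apply/gradedP => S a; rewrite cycle_eltE; case: (a =P ind set0) => [->|_]; last by rewrite eqxx.
  by rewrite ind0 /tdeg big1 // => i _; rewrite ffunE.
have e0E S : cycle_elt c0 S 0 = w0 S by rewrite cycle_eltE ind0 eqxx.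
split=> // [p p0|e cane].
  apply/SR_idealP => m pm; apply/negP => mD; have [S mS wS] := ex0 _ mD.
  have := scale_graded0 p ce ge mS; rewrite p0 cousin0E e0E => /esym/eqP.
  by rewrite mulf_eq0 (negbTE pm) (negbTE wS).
have /choice[c hc] (m : 'X_{1..n}) : exists c, forall S,
    msup m \subset S -> e S (mexp m) = c * w0 S.
  have [mD|mD] := boolP (msup m \in faces D); first exact: gen0 (canon_relcycle m cane).
  exists 0 => S mS; rewrite mul0r; apply/eqP/negPn/negP => h; case/negP: mD.
  have [SD _] := canon_facet cane h; exact: faces_sub SD.
have [B hB] := (cousinP e).2.
(* The coefficient of [m] is the ratio of [e] in multidegree [m] to [w0]; beyond the degree bound
   [B] of [e] there is nothing to match. *)
exists (\sum_(m : 'X_{1..n < `|B|.+1}) (if msup m \in faces D then c m else 0) *: 'X_[m]).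
apply: canon_eq => [||S m mS]; [exact: cane|exact: canonZ|].
rewrite scale_graded0 // e0E.
have [lt_m|le_m] := ltnP (mdeg m) `|B|.+1.
  rewrite (mcoeff_mpoly (fun m => if msup m \in faces D then c m else 0)) //.
  case: ifP => mD; first exact: hc.
  rewrite mul0r; apply/eqP/negPn/negP => h; have [SD _] := canon_facet cane h.
  by rewrite (faces_sub mS SD) in mD.
rewrite hB; last by rewrite tdeg_mexp; lia.
rewrite raddf_sum big1 ?mul0r //= => -[m' lt_m'] _; rewrite mcoeffZ mcoeffX /=.
by case: eqP lt_m' le_m => [->|]; rewrite ?mulr0 // => h; rewrite leqNgt h.
Qed.

End CanonCycles.

(** * Graded isomorphisms with k[D] as generators of degree 0 *)

Section GradedIso.
Variables (k : fieldType) (n : nat) (D : scomplex n) (M : gmod {mpoly k[n]}).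
Local Notation R := {mpoly k[n]}.
Local Notation E := (cousin k n).
Variable phi : {linear M -> E}.
Hypotheses (phi_inj : injective phi)
  (phiP : forall e, canon D e <-> exists h, phi h = e)
  (phi_graded : forall j h, gpiece j h <-> graded j (phi h)).

Lemma graded_iso_generator : graded_iso M (SR_gmod k D) -> exists e0 : E, generator D e0.
Proof.
move=> [f [g fK gK] gf]; exists (phi (g (SR_pi D 1))).
have e0E (p : R) : p *: phi (g (SR_pi D 1)) = phi (g (SR_pi D p)).
  rewrite -linearZ; congr (phi _); apply: (can_inj fK); rewrite linearZ !gK.
  by have := SR_scaleE D p 1; rewrite mulr1.
split.
- by apply/phiP; exists (g (SR_pi D 1)).
- apply/phi_graded/gf; rewrite gK; exists 1 => //; exact: dhomog1.
- move=> p; rewrite e0E => h0; apply/SR_pi0; rewrite -[SR_pi D p]gK.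
  have /phi_inj -> : phi (g (SR_pi D p)) = phi 0 by rewrite h0 linear0.
  exact: linear0.
move=> e /phiP[h <-]; have [p hp] := SR_pi_surj (f h).
by exists p; rewrite e0E -hp fK.
Qed.

Lemma generator_graded_iso (e0 : E) : generator D e0 -> graded_iso M (SR_gmod k D).
Proof.
move=> [c0 g0 inj0 gen0].
have pi_eq p q : p *: e0 = q *: e0 -> SR_pi D p = SR_pi D q.
  by move=> e; apply/SR_piE/inj0; rewrite scalerBl e subrr.
have eq_pi p q : SR_pi D p = SR_pi D q -> p *: e0 = q *: e0.
  move=> /SR_piE pq; apply/eqP; rewrite -subr_eq0 -scalerBl; apply/eqP.
  by have [_ _ ->] := c0.
have /choice[q hq] h : exists p, phi h = p *: e0 by apply/gen0/phiP; exists h.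
pose f h : SR_gmod k D := SR_pi D (q h).
have lin : linear f.
  move=> p h h'; rewrite /f SR_scaleE -rmorphD; apply: pi_eq.
  by rewrite -hq linearP !hq scalerDl scalerA.
have /choice[g hg] (x : SR_gmod k D) : exists h, x = f h.
  have [p ->] := SR_pi_surj x.
  have /phiP[h he] : canon D (p *: e0) by apply: canonZ.
  by exists h; apply: pi_eq; rewrite -hq he.
have finj : injective f by move=> h h' /eq_pi; rewrite -!hq => /phi_inj.
exists (HB.pack_for {linear M -> SR_gmod k D} f (GRing.isLinear.Build _ _ _ _ f lin)).
  by exists g => [h|x]; [apply: finj; apply: esym (hg _) | apply: esym (hg _)].
move=> j h; rewrite phi_graded hq; split=> [/(canon_piece c0 g0)[p pj e]|[p pj /eq_pi e]].
  by exists p => //; apply: pi_eq.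
by rewrite e /graded -[j in homc j]addr0 homc_pieceZ // g0.
Qed.

End GradedIso.

(** * Top homology *)

Section TopHomology.
Variables (k : fieldType) (n : nat) (D : scomplex n).
Local Notation d := (top_card D).
Implicit Types (H S : {set 'I_n}) (w : {set 'I_n} -> k).

Lemma sum_incidence w H :
  \sum_S incidence k S H * w S = \sum_(v | v \notin H) sgn k v H * w (v |: H).
Proof.
under eq_bigr do rewrite /incidence mulr_suml.
rewrite (exchange_big_dep (fun v => v \notin H)) /=; last first.
  by move=> S v _ /andP[_ /eqP ->]; rewrite setD11.
apply: eq_bigr => v vH; rewrite (big_pred1 (v |: H)) => [|S].
  by rewrite -/(sgn k v (v |: H)) sgnU // ltnn mul1r.
apply/andP/eqP => [[vS /eqP ->]|->]; first by rewrite setD1K.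
by rewrite setU11 setU1K.
Qed.

Lemma sum_face_of_dim i (f : {set 'I_n} -> k) :
  (forall S, f S != 0 -> S \in faces D /\ fdim S = i) ->
  \sum_(s : face_of_dim D i) f (val s) = \sum_S f S.
Proof.
move=> fi; rewrite [RHS](bigID (fun S => (S \in faces D) && (fdim S == i))) /=.
rewrite [X in _ = _ + X]big1 ?addr0 => [|S Si]; last first.
  by apply: contraNeq Si => /fi[-> ->]; rewrite eqxx.
rewrite [RHS](reindex_omap (val : face_of_dim D i -> _) insub) /=; last first.
  by move=> S Si; rewrite insubT.
by apply: eq_bigl => s; rewrite (valP s) valK eqxx.
Qed.

Definition ext0 i (z : {ffun face_of_dim D i -> k^o}) S : k := oapp z 0 (insub S).

Lemma ext0_val i (z : {ffun face_of_dim D i -> k^o}) s : ext0 z (val s) = z s.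
Proof. by rewrite /ext0 valK. Qed.

Lemma ext0_supp i (z : {ffun face_of_dim D i -> k^o}) S : ext0 z S != 0 ->
  S \in faces D /\ fdim S = i.
Proof.
rewrite /ext0; case: insubP => [s|_] /=; last by rewrite eqxx.
by case/andP => SD /eqP Si _.
Qed.

Lemma boundary_ext0 i j (z : chain D k i) (t : face_of_dim D j) :
  boundary D k i j z t =
  \sum_(v | v \notin val t) sgn k v (val t) * ext0 z (v |: val t).
Proof.
rewrite -sum_incidence ffunE -(sum_face_of_dim (i := i)) => [|S].
  by apply: eq_bigr => s _; rewrite ext0_val.
by rewrite mulf_eq0 negb_or => /andP[_ /ext0_supp].
Qed.

Lemma top_cycleP (z : chain D k (cdim D)) :
  boundary D k (cdim D) (cdim D - 1) z = 0 <-> relcycle D set0 (ext0 z).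
Proof.
split=> [bz|[_ wz]]; last first.
  by apply/ffunP => t; rewrite boundary_ext0 wz ?sub0set // ffunE.
split=> [S /ext0_supp[SD /fdim_top cS]|H _]; first by split; rewrite ?sub0set.
have [HH|nH] := boolP ((H \in faces D) && (fdim H == cdim D - 1)).
  have := congr1 (fun f : {ffun _ -> _} => f (exist _ H HH)) bz.
  by rewrite boundary_ext0 ffunE.
rewrite big1 // => v vH; have [->|/ext0_supp[SD /fdim_top cS]] := eqVneq (ext0 z (v |: H)) 0.
  by rewrite mulr0.
case/negP: nH; rewrite (faces_sub (subsetUr _ _) SD) /= /fdim cdimE.
by move: cS; rewrite cardsU1 vH => <-; move: #|H| => x; clear; lia.
Qed.

Lemma top_homologyP :
  (exists h : simplicial_homology D k (cdim D), h != 0) <->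
  exists w S, relcycle D set0 w /\ w S != 0 :> k.
Proof.
split=> [[h h0]|[w [S [cw wS]]]].
  have [z hz] := homology_classP h.
  have cz : relcycle D set0 (ext0 (val z)).
    by apply/top_cycleP/eqP; apply: (valP z).
  have [S wS] : exists S, ext0 (val z) S != 0.
    apply: contrapT => none; case/negP: h0; rewrite hz.
    rewrite (_ : z = 0) ?homology_class0 //; apply/val_inj/ffunP => s.
    rewrite -ext0_val [RHS]ffunE; apply/eqP/negPn/negP => zs; case: none.
    by exists (val s).
  by exists (ext0 (val z)), S.
pose z : chain D k (cdim D) := [ffun s => w (val s)].
have zw T : ext0 z T = w T.
  rewrite /ext0; case: insubP => [s _ <-|] /=; first by rewrite ffunE.
  move=> nT; apply/esym/eqP; apply: contraNT nT => /(cw.1)[-> /fdim_top -> _].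
  by rewrite eqxx.
have bz : z \in in_ker (boundary D k (cdim D) (cdim D - 1)).
  apply/eqP/top_cycleP; have -> : ext0 z = w by apply/funext.
  exact: cw.
exists (homology_class (boundary D k (cdim D + 1) (cdim D)) (exist _ z bz)).
apply/negP => /eqP; rewrite -(homology_class0 (boundary D k (cdim D + 1) (cdim D))).
(* No face has dimension above [cdim D], so the boundary of [u] is an empty sum and a nonzero top
   cycle is not a boundary. *)
move=> /homology_class_eq[u]; rewrite subr0 /= => hu.
have [SD /fdim_top cS _] := cw.1 S wS.
have Sface : (S \in faces D) && (fdim S == cdim D) by rewrite SD cS eqxx.
have := congr1 (fun f : {ffun _ -> _} => f (exist _ S Sface)) hu.
rewrite /= boundary_ext0 ffunE /= big1 => [/esym/eqP|v vS]; first by rewrite (negbTE wS).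
have [->|/ext0_supp[TD]] := eqVneq (ext0 u (v |: S)) 0; first by rewrite mulr0.
move=> Td; exfalso; have := top_card_ge TD; move: Td.
rewrite /fdim cdimE; move: #|_| => x; clear; lia.
Qed.

End TopHomology.

(** * Krull dimension *)

Lemma ker_nontrivial (k : fieldType) (I J : finType)
    (phi : {linear {ffun I -> k^o} -> {ffun J -> k^o}}) :
  (#|J| < #|I|)%N -> exists2 c, c != 0 & phi c = 0.
Proof.
move=> JI; pose f := linfun phi.
have : lker f != 0%VS.
  apply: contraTneq JI => f0; rewrite -leqNgt.
  have := limg_ker_dim f fullv; rewrite f0 capv0 dimv0 add0n dimvf => e.
  have := dimvS (subvf (f @: fullv)%VS); rewrite e dimvf /dim /= /dim /=.
  by rewrite !muln1.
rewrite -subv0 => /subvPn[c]; rewrite memv_ker memv0 lfunE => /eqP phi0 c0.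
by exists c.
Qed.

(** * Upper bound for the Krull dimension: independence along a chain of primes *)

Section NestedPolynomials.
Variables (k : fieldType) (B : comNzRingType) (iota : {rmorphism k -> B}) (N : nat).

(* The value at [y] of the polynomial in [r] variables, of degree less than [N]
   in each of them, whose coefficients are given by [c]. *)
Fixpoint nest r (y : nat -> B) (c : seq nat -> k) : B :=
  match r with
  | 0 => iota (c [::])
  | r'.+1 => \sum_(j < N) y 0%N ^+ j * nest r' (fun i => y i.+1) (fun s => c (val j :: s))
  end.

Lemma nest_linear r y a c c' :
  nest r y (fun s => a * c s + c' s) = iota a * nest r y c + nest r y c'.
Proof.
elim: r y c c' => [|r IH] y c c' /=; first by rewrite rmorphD rmorphM.
rewrite mulr_sumr -big_split; apply: eq_bigr => j _ /=.
by rewrite IH mulrDr mulrCA.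
Qed.

Lemma nest0 r y c : (forall s, size s = r -> all (fun j => j < N)%N s -> c s = 0) ->
  nest r y c = 0.
Proof.
elim: r y c => [|r IH] y c c0 /=; first by rewrite c0 ?rmorph0.
rewrite big1 // => j _; rewrite IH ?mulr0 // => s ss sN.
by apply: c0 => /=; rewrite ?ss ?ltn_ord.
Qed.

(** Factor out the lowest power of [y 0] that is left. It is outside the prime [P 0], so the
    cofactor is in [P 0], hence in [P 1]; since [y 0] is in [P 1] too, so is the lowest coefficient,
    and the induction applies to it and the chain shifted by one. *)
Lemma nest_independent r (P : nat -> prime_idealr B) y c :
  (forall i, (i < r)%N -> [/\ y i \in P i.+1, y i \notin P i & {subset P i <= P i.+1}]) ->
  nest r y c \in P 0%N ->
  forall s, size s = r -> all (fun j => j < N)%N s -> c s = 0.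
Proof.
elim: r P y c => [|r IH] P y c hy.
  move=> c0 [|//] _ _; apply/eqP; move: c0; apply: contraLR => cn0 /=.
  apply/negP => /(idealMr (iota (c [::])^-1)).
  by rewrite -rmorphM mulVf // rmorph1 idealr1.
move=> nP0 [//|j s] [ss] /= /andP[jN sN].
have [y1 y0 P01] := hy 0%N isT.
elim/ltn_ind: j jN s ss sN => j IHj jN s ss sN.
pose Z (i : nat) := nest r (fun i => y i.+1) (fun s => c (i :: s)).
have ZP1 : Z j \in P 1%N.
  pose W := \sum_(i < N | (j < i)%N) y 0%N ^+ (i - j.+1) * Z i.
  have e : nest r.+1 y c = y 0%N ^+ j * (Z j + y 0%N * W).
    rewrite /= (bigID (fun i : 'I_N => (i < j)%N)) /= big1 ?add0r => [|i ij]; last first.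
      rewrite nest0 ?mulr0 // => s' ss' sN'; exact: IHj.
    rewrite (bigD1 (Ordinal jN)) /=; last by rewrite ltnn.
    rewrite mulrDr; congr (_ + _); rewrite mulrA -exprSr mulr_sumr.
    apply: eq_big => [i|i /andP[]].
      by rewrite -leqNgt ltn_neqAle andbC; congr (_ && _); rewrite eq_sym.
    rewrite -leqNgt => ji ne; have lt_ji : (j < i)%N by rewrite ltn_neqAle eq_sym ji andbT.
    by rewrite mulrA -exprD subnKC.
  move: nP0; rewrite e prime_idealrM => /orP[y0j|ZW].
    exfalso; move: y0j; elim: (j) => [|j' IHj']; first by rewrite expr0 idealr1.
    by rewrite exprS prime_idealrM (negbTE y0).
  have := P01 _ ZW; rewrite -{2}[Z j](addrK (y 0%N * W)) => h.
  by apply: rpredB => //; rewrite mulrC; apply: idealMr.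
apply: (IH (fun i => P i.+1) (fun i => y i.+1) (fun s => c (j :: s))) => //.
by move=> i ir; apply: hy.
Qed.

End NestedPolynomials.

Section NestedSize.
Variables (k : fieldType) (n N : nat).
Local Notation R := {mpoly k[n]}.
Local Notation nest := (nest (@mpolyC n k) N).

Lemma msize_nest r (y : nat -> R) c t : (forall i, msize (y i) <= t)%N ->
  (msize (nest r y c) <= r * (N * t.+1 + 2) + 1)%N.
Proof.
move=> yt; elim: r y c yt => [|r IH] y c yt.
  by rewrite msizeC; case: (_ == _).
rewrite /=; apply: leq_trans (msize_sum _ _ _) _; apply/bigmax_leqP => j _.
have pow : (msize (y 0%N ^+ j) <= j * t.+1 + 1)%N.
  elim: (val j) => [|i IHi]; first by rewrite expr0 msize1.
  rewrite exprS; apply: leq_trans (msizeM_le _ _) _.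
  by have := yt 0%N; move: (msize _) (msize _) IHi => x z; nia.
apply: leq_trans (msizeM_le _ _) _.
have := IH _ (fun s => c (nat_of_ord j :: s)) (fun i => yt i.+1); rewrite mulSn.
have : (j * t.+1 <= N * t.+1)%N by rewrite leq_mul // ltnW.
have arith (x z a b e : nat) :
  (x <= a + 1 -> a <= b -> z <= e + 1 -> x + z < b + 2 + e + 1)%N by clear; lia.
exact: arith pow.
Qed.

End NestedSize.


Section KrullDimension.
Variables (k : fieldType) (n : nat) (D : scomplex n).
Local Notation R := {mpoly k[n]}.
Local Notation A := (SR_ring k D).
Local Notation d := (top_card D).

Definition scalar : k -> A := SR_pi D \o @mpolyC n k.
HB.instance Definition _ := GRing.RMorphism.on scalar.

Lemma SR_pi_nest N r (y : nat -> R) c :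
  SR_pi D (nest (@mpolyC n k) N r y c) = nest scalar N r (fun i => SR_pi D (y i)) c.
Proof.
elim: r y c => [|r IH] y c //=; rewrite rmorph_sum; apply: eq_bigr => j _.
by rewrite [LHS]rmorphM rmorphXn -IH.
Qed.

(** The left side bounds the number of monomials in [e] variables that can occur, the right side
    counts the coefficients in e + 1 variables. The base on the left is at most N times
    [(e.+1 * t.+3).+1], and N exceeds the e-th power of that factor. *)
Lemma counting_bound t e N : N = ((e.+1 * t.+3).+1 ^ e).+1 ->
  ((e.+1 * (N * t.+1 + 2) + 1) ^ e < N ^ e.+1)%N.
Proof.
move=> eN; have N0 : (0 < N)%N by rewrite eN.
apply: (@leq_ltn_trans ((N * (e.+1 * t.+3).+1) ^ e)).
  case: e eN => // e _; rewrite leq_exp2r //.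
  rewrite mulnS addn1 addnC -addn1 addnC; clear -N0; nia.
by rewrite expnMn [(N ^ e.+1)%N]expnSr ltn_pmul2l ?expn_gt0 ?N0 // [X in (_ < X)%N]eN.
Qed.

(* The variables outside of [P 0] form a face, so any more than [d] elements are
   algebraically dependent modulo [P 0]. *)
Lemma prime_chain_le e : prime_chain A e -> (e <= d)%N.
Proof.
move=> [P chain]; rewrite leqNgt; apply/negP => de.
pose G := [set v | SR_pi D 'X_v \notin P 0%N].
have GD : G \in faces D.
  apply/negPn/negP => GD.
  have : SR_pi D 'X_[mnm_ind G] \in P 0%N.
    rewrite (_ : SR_pi D _ = 0) ?rpred0 //.
    by have := SR_kill GD (SR_pi D (1 : R)); rewrite SR_scaleE mulr1.
  rewrite -prod_mpolyX rmorph_prod.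
  apply/negP; elim/big_ind: _ => [|x z nx nz|v]; first by rewrite idealr1.
    by rewrite prime_idealrM negb_or nx.
  by rewrite inE.
have /choice[y hy] i : exists p : R, (i < e)%N ->
    SR_pi D p \in P i.+1 /\ SR_pi D p \notin P i.
  have [ie|_] := ltnP i e; last by exists 0.
  have [_ nsub] := chain i ie.
  have [x [xP nxP]] : exists x, x \in P i.+1 /\ x \notin P i.
    apply: contrapT => none; apply: nsub => x xP; apply/negPn/negP => nx.
    by apply: none; exists x.
  by have [p xp] := SR_pi_surj x; exists p; rewrite -xp.
pose r := d.+1.
pose t := \max_(i < r) msize (y i).
(* Truncated to zero from r on, so that [t] bounds the size at every index, as [msize_nest] asks. *)
pose y' i := if (i < r)%N then y i else 0.
have yt i : (msize (y' i) <= t)%N.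
  rewrite /y'; case: ltnP => ir; last by rewrite msize0.
  exact: (leq_bigmax (Ordinal ir)).
pose N := ((r * t.+3).+1 ^ d).+1.
pose L := (r * (N * t.+1 + 2) + 1)%N.
(* [I] indexes the unknown coefficients of a relation among the [y i], and [J] the monomials
   supported on [G] that its value may contain. *)
pose I : finType := {ffun 'I_r -> 'I_N}.
pose J : finType := {ffun {v | v \in G} -> 'I_L}.
have JI : (#|J| < #|I|)%N.
  rewrite !card_ffun !card_ord card_sig; apply: leq_ltn_trans (@counting_bound t d N _) => //.
  by apply: leq_pexp2l; [rewrite /L addn1 | exact: top_card_ge].
pose mJ (j : J) : 'X_{1..n} := [multinom oapp (fun v => nat_of_ord (j v)) 0%N (insub i) | i < n].
pose cI (c : {ffun I -> k^o}) (s : seq nat) : k := c [ffun i : 'I_r => inord (nth 0%N s i)].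
pose phi (c : {ffun I -> k^o}) : {ffun J -> k^o} :=
  [ffun j => (nest (@mpolyC n k) N r y' (cI c))@_(mJ j)].
have phi_lin : linear phi.
  move=> a c c'; apply/ffunP => j; rewrite !ffunE.
  rewrite (_ : cI _ = fun s => a * cI c s + cI c' s); last first.
    by apply/funext => s; rewrite /cI !ffunE.
  by rewrite nest_linear mcoeffD mcoeffCM.
pose f : {linear {ffun I -> k^o} -> {ffun J -> k^o}} :=
  HB.pack phi (GRing.isLinear.Build _ _ _ _ phi phi_lin).
have [c c0 fc] := @ker_nontrivial _ _ _ f JI.
case/negP: c0; apply/eqP/ffunP => b; rewrite [RHS]ffunE.
pose s := [seq nat_of_ord (b i) | i <- enum 'I_r].
have <- : cI c s = c b.
  congr (c _); apply/ffunP => i; rewrite ffunE (nth_map i) ?size_enum_ord //.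
  by rewrite nth_ord_enum inord_val.
apply: (@nest_independent k A scalar N r P (fun i => SR_pi D (y' i)) (cI c)).
- move=> i ir; have ie : (i < e)%N by apply: leq_trans ir de.
  have [sub _] := chain i ie; have [h1 h2] := hy i ie.
  by rewrite /y' ir; split.
- rewrite -SR_pi_nest [X in SR_pi D X]mpolyE rmorph_sum big_seq rpred_sum // => m mp.
  (* The monomials supported on [G] were cancelled by the choice of [c]; any other one involves a
     variable that lies in [P 0]. *)
  have /subsetPn[v vm vG] : ~~ (msup m \subset G).
    apply/negP => mG; move: (mp); rewrite mcoeff_msupp; apply/negP; rewrite negbK.
    have mL v : (m v < L)%N.
      apply: leq_trans (msize_nest _ _ _ yt).
      apply: leq_ltn_trans (msize_mdeg_lt mp).
      by rewrite mdegE (bigD1 v) //= leq_addr.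
    have -> : m = mJ [ffun v : {v | v \in G} => Ordinal (mL (val v))].
      apply/mnmP => v; rewrite mnmE; case: insubP => [w _ <-|vG] /=; first by rewrite ffunE.
      by apply/eqP; apply: contraNT vG => mv; apply: (subsetP mG); rewrite inE.
    by rewrite -[X in X == _](ffunE (fun j => (nest (@mpolyC n k) N r y' (cI c))@_(mJ j))) [X in fun_of_fin X]fc ffunE.
  have Uv : (U_(v) <= m)%MM by rewrite lep1mP; move: vm; rewrite inE.
  rewrite -(submK Uv) mpolyXD -mul_mpolyC mulrA rmorphM; apply: idealMr.
  by move: vG; rewrite inE negbK.
- by rewrite size_map size_enum_ord.
by apply/allP => i /mapP[x _ ->]; apply: ltn_ord.
Qed.

End KrullDimension.

(** * Lower bound for the Krull dimension: the primes attached to faces *)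

Section FacePrime.
Variables (k : fieldType) (n : nat) (D : scomplex n).
Local Notation R := {mpoly k[n]}.
Local Notation A := (SR_ring k D).
Local Notation d := (top_card D).
Variables (F : {set 'I_n}) (FD : F \in faces D).

Definition face_vars : n.-tuple R := [tuple (if i \in F then 'X_i else 0) | i < n].
Local Notation kill_out := (comp_mpoly face_vars).

Lemma kill_outX m : kill_out 'X_[m] = if msup m \subset F then 'X_[m] else 0.
Proof.
rewrite comp_mpolyX; case: ifP => [mF|/negbT/subsetPn[v vm vF]].
  rewrite mpolyXE_id; apply: eq_bigr => i _; rewrite tnth_mktuple.
  case: (boolP (i \in F)) => // iF; have /eqP -> : m i == 0%N.
    by apply: contraNT iF => mi; apply: (subsetP mF); rewrite inE.
  by rewrite !expr0.
rewrite (bigD1 v) //= tnth_mktuple (negbTE vF) expr0n; move: vm; rewrite inE.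
by move/negbTE ->; rewrite mul0r.
Qed.

Lemma kill_out_eq0 p : (kill_out p = 0) <-> (forall m, msup m \subset F -> p@_m = 0).
Proof.
have coef m : (kill_out p)@_m = if msup m \subset F then p@_m else 0.
  rewrite {1}[p]mpolyE rmorph_sum raddf_sum mcoeff_mform /mform /=.
  rewrite (eq_bigr (fun m' => if msup m \subset F then p@_m' * (m' == m)%:R else 0)).
    by case: ifP => // _; rewrite big1.
  move=> m' _; rewrite -mul_mpolyC rmorphM /= comp_mpolyC mcoeffCM kill_outX.
  have [->|mm'] := eqVneq m' m.
    by case: ifP; rewrite ?mcoeffX ?eqxx // mcoeff0 mulr0.
  by case: ifP; rewrite ?mcoeff0 ?mcoeffX ?(negbTE mm') mulr0 if_same.
split=> [p0 m mF|p0]; first by have := coef m; rewrite mF p0 mcoeff0.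
by apply/mpolyP => m; rewrite coef mcoeff0; case: ifP => // /p0.
Qed.

(** The kernel of the projection from k[D] to the polynomial ring on the vertices of [F]. The chosen
    representative does not matter, because the ideal contains no monomial supported on a face. *)
Definition face_prime : pred A := fun x => kill_out (repr x) == 0.

Lemma face_primeE p : (SR_pi D p \in face_prime) = (kill_out p == 0).
Proof.
have pI : repr (SR_pi D p) - p \in SR_ideal D.
  by apply/SR_piE; rewrite /SR_pi reprK.
have k0 : kill_out (repr (SR_pi D p) - p) = 0.
  apply/kill_out_eq0 => m mF.
  by apply/eqP; apply: contraTT (faces_sub mF FD) => /(SR_idealP _ _ pI).
by rewrite unfold_in /face_prime -[X in kill_out X](subrK p) comp_mpolyD k0 add0r.
Qed.

Lemma face_prime_idealr : idealr_closed face_prime.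
Proof.
split.
- by rewrite -(raddf0 (SR_pi D)) face_primeE raddf0.
- by rewrite -(rmorph1 (SR_pi D)) face_primeE rmorph1 oner_eq0.
move=> a x y; have [p ->] := SR_pi_surj a; have [q ->] := SR_pi_surj x.
have [r ->] := SR_pi_surj y; rewrite -rmorphM -rmorphD !face_primeE comp_mpolyD rmorphM /=.
by move=> /eqP -> /eqP ->; rewrite mulr0 addr0.
Qed.
HB.instance Definition _ := isIdealr.Build A face_prime face_prime_idealr.

Lemma face_prime_prime : prime_idealr_closed face_prime.
Proof.
move=> x y; have [p ->] := SR_pi_surj x; have [q ->] := SR_pi_surj y.
by rewrite -rmorphM !face_primeE rmorphM mulf_eq0.
Qed.
HB.instance Definition _ := isPrimeIdealrClosed.Build A face_prime face_prime_prime.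

Definition face_prime_idealr_of : prime_idealr A := face_prime.

End FacePrime.

Section KrullDimensionE.
Variables (k : fieldType) (n : nat) (D : scomplex n).
Local Notation A := (SR_ring k D).
Local Notation d := (top_card D).

Lemma prime_chain_top : prime_chain A d.
Proof.
have [G GD cG] : {G | G \in faces D & d = #|G|}.
  by apply: eq_bigmax_cond; apply/card_gt0P; exists set0; apply: faces0.
(* A flag of faces losing one vertex of [G] at a time; the corresponding primes grow, each step
   gaining the variable of the lost vertex. *)
pose F i := [set v in drop i (enum G)].
have FG i : F i \in faces D.
  apply: faces_sub GD; apply/subsetP => v; rewrite inE => /mem_drop.
  by rewrite mem_enum.
exists (fun i => face_prime_idealr_of k (FG i)) => i id.
have sz : (i < size (enum G))%N by rewrite -cardE -cG.
have [v0 _] : exists v, v \in G by apply/card_gt0P; rewrite -cG; apply: leq_ltn_trans id.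
have dropE := drop_nth v0 sz.
have FS : F i.+1 \subset F i.
  by apply/subsetP => v; rewrite !inE dropE inE => ->; rewrite orbT.
split=> [x|sub].
  have [p ->] := SR_pi_surj x; rewrite !(face_primeE (FG _)).
  by move=> /eqP/kill_out_eq0 p0; apply/eqP/kill_out_eq0 => m mF; apply: p0; apply: subset_trans FS.
pose v := nth v0 (enum G) i.
have vi : v \in F i by rewrite inE dropE mem_head.
have vS : v \notin F i.+1.
  rewrite inE; have : uniq (drop i (enum G)) by rewrite drop_uniq ?enum_uniq.
  by rewrite dropE => /= /andP[].
have mU : msup U_(v)%MM = [set v].
  by apply/setP => u; rewrite !inE mnm1E eqb0 negbK eq_sym.
have := sub (SR_pi D 'X_v); rewrite !(face_primeE (FG _)) !kill_outX mU.
rewrite !sub1set vi (negbTE vS) eqxx => /(_ isT)/eqP/mpolyP/(_ U_(v)%MM).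
by rewrite mcoeffX eqxx mcoeff0 => /eqP; rewrite oner_eq0.
Qed.

Lemma krull_dimE : krull_dim A = d.
Proof.
have isd : is_krull_dim A d by split; [exact: prime_chain_top | exact: prime_chain_le].
rewrite /krull_dim; case: pselect => [ex|]; last by case; exists d.
have [c1 c2] := svalP (cid ex); apply/eqP; rewrite eqn_leq.
by rewrite (prime_chain_le c1) c2 //; exact: prime_chain_top.
Qed.

End KrullDimensionE.

Theorem theorem4p4 (k : fieldType) (n : nat) (D : scomplex n)
    (F : gresolution (SR_gmod k D)) :
  graded_iso (omega F) (SR_gmod k D) <->
  normal_pseudomanifold D /\
  (exists h : simplicial_homology D k (cdim D), h != 0%R).
Proof.
have [|phi [phi_inj phiP phi_graded]] := @ext_canon k n D F (n - krull_dim (SR_ring k D)).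
  by rewrite krull_dimE subnKC // top_card_le_n.
rewrite top_homologyP; split.
  move=> /(graded_iso_generator phi_inj phiP phi_graded)[e0 /generator_generates gen].
  have [pm [S wS]] := generates_pm gen; split=> //.
  by exists (fun S => e0 S 0), S; split=> //; case: gen.
move=> [pm [w [S [cw wS]]]].
have [e0 gen] := generates_generator (pm_generates pm cw wS).
exact: (generator_graded_iso phi_inj phiP phi_graded gen).
Qed.
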